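(* Let $d\ge 1$, let $q(\boldsymbol{x})=\prod_{j=1}^d q_j(x_j)$ be a probability density on $\mathbb{R}^d$ of product form, and let $f:\mathbb{R}^d\to\mathbb{R}$ be such that $f/q\in\mathcal{S}(\mathbb{R}^d)$ and there are constants $A,B,C>0$ with $$\sup_{\boldsymbol{u}\subseteq\{1,\dots,d\}}\left|\partial^{\boldsymbol{u}}\left(\frac{f}{q}\right)(\boldsymbol{x})\right|\le C e^{A|\boldsymbol{x}|^2+B|\boldsymbol{x}|}\qquad\text{for all }\boldsymbol{x}\in\mathbb{R}^d .$$ Let $\boldsymbol{X}$ be a $d$-dimensional standard normal vector under $\mathbb{E}$, and let $\widehat{I}_n^{IS}(f)$ be the RQMC importance sampling estimator built from RQMC point sets as specified in the context. Then, as $n\to\infty$: (a) If $A<\tfrac12$ and $\mathbb{E}_q[|\boldsymbol{X}|^2]<\infty$, then $$\mathbb{E}\left[\left(\widehat{I}_n^{IS}(f)-\mathbb{E}[f(\boldsymbol{X})]\right)^2\right]=O\left(n^{-2}(\log n)^{3d-2}\right).$$ (b) If $A=\tfrac12$ and there exist constants $\alpha>0$, $\beta>0$, $\gamma>1$, $C_0>0$ such that, for every $R>1$, $$\mathbb{E}_q\left[|\boldsymbol{X}|^4e^{2B|\boldsymbol{X}|}\mathbb{I}_{\{|\boldsymbol{X}|\ge R-1\}}\right]\le C_0R^{\alpha}e^{-\beta R^{\gamma}}$$ (with $B$ the same constant as in the growth bound on $f/q$), then $$\mathbb{E}\left[\left(\widehat{I}_n^{IS}(f)-\mathbb{E}[f(\boldsymbol{X})]\right)^2\right]=O\left(n^{-2}(\log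 n)^{4d/\gamma+2d-2}\,e^{2\sqrt{d}\,B(2/\beta)^{1/\gamma}(\log n)^{1/\gamma}}\right).$$
   Context: $|\cdot|$ is the Euclidean norm. For $\boldsymbol{u}\subseteq\{1,\dots,d\}$, $\partial^{\boldsymbol{u}}$ denotes the mixed partial derivative taken once with respect to each $x_j$, $j\in\boldsymbol{u}$ ($\partial^{\varnothing}f=f$). $\mathcal{S}(\mathbb{R}^d)$ is the class of functions on $\mathbb{R}^d$ for which $\partial^{\boldsymbol{u}}f$ exists and is continuous for every $\boldsymbol{u}\subseteq\{1,\dots,d\}$. $\varphi$ is the $d$-dimensional standard normal density. The proposal density $q=\prod_j q_j$ is positive (so that $f/q$ makes sense); $G_j$ is the cumulative distribution function of $q_j$ and $G^{-1}(\boldsymbol{y})=(G_1^{-1}(y_1),\dots,G_d^{-1}(y_d))$. $\mathbb{E}_q$ denotes expectation when $\boldsymbol{X}$ has density $q$. Put $f_{IS}:=\varphi f/q$. For each $n$, $\{\boldsymbol{y}_1,\dots,\boldsymbol{y}_n\}$ is an RQMC (random) point set in $[0,1)^d$ such that each $\boldsymbol{y}_j$ is uniformly distributed on the unit cube and, almost surely, its star discrepancy satisfies $D_n^*(\{\boldsymbol{y}_1,\dots,\boldsymbol{y}_n\})\le C'(\log n)^{d-1}/n$ with a constant $C'$ independent of $n$. The star discrepancy is $D_n^*=\sup_{\boldsymbol{a}\in[0,1]^d}\left|\frac1n\#\{j:\boldsymbol{y}_j\in[\boldsymbol{0},\boldsymbol{a})\}-\prod_{i=1}^d a_i\right|$.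 The estimator is $$\widehat{I}_n^{IS}(f)=\frac1n\sum_{j=1}^n f_{IS}\circ G^{-1}(\boldsymbol{y}_j).$$ *)

(* Defs.v *)
From HB Require Import structures.
From mathcomp Require Import all_boot all_order all_algebra.
From mathcomp Require Import all_classical all_reals all_analysis.

Set Implicit Arguments.
Unset Strict Implicit.
Unset Printing Implicit Defensive.

Import Order.TTheory GRing.Theory Num.Theory.
Import numFieldNormedType.Exports.

Local Open Scope classical_set_scope.
Local Open Scope ring_scope.

(* Row vectors carry the sigma-algebra generated by the coordinates; over a
   realType this is the Borel sigma-algebra of R^n. *)
Section measurable_row.
Context {d} {T : sigmaRingType d}.
Variable n : nat.

Let coors : 'I_n -> 'rV[T]_n -> T := fun i x => x ord0 i.

Let row_set0 : g_sigma_preimage coors set0.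
Proof. exact: sigma_algebra0. Qed.

Let row_setC A : g_sigma_preimage coors A -> g_sigma_preimage coors (~` A).
Proof. exact: sigma_algebraC. Qed.

Let row_bigcup (F : _^nat) : (forall i, g_sigma_preimage coors (F i)) ->
  g_sigma_preimage coors (\bigcup_i (F i)).
Proof. exact: sigma_algebra_bigcup. Qed.

HB.instance Definition _ := @isMeasurable.Build (measure_tuple_display d)
  'rV[T]_n (g_sigma_preimage coors) row_set0 row_setC row_bigcup.

End measurable_row.

Section measurable_row_theory.
Context d' (T' : measurableType d') d (T : measurableType d).

Lemma measurable_coord n (i : 'I_n) :
  measurable_fun [set: 'rV[T]_n] (fun x => x ord0 i).
Proof.
move=> _ Y mY; rewrite setTI; apply: sub_sigma_algebra => /=.
rewrite -bigcup_seq/=; exists i => /=; first by rewrite mem_index_enum.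
by exists Y => //; rewrite setTI.
Qed.

Lemma measurable_fun_row n (f : T' -> 'rV[T]_n) :
  (forall i, measurable_fun [set: T'] (fun x => f x ord0 i)) ->
  measurable_fun [set: T'] f.
Proof.
move=> mf.
have : g_sigma_preimage (fun (i : 'I_n) x => f x ord0 i) `<=` measurable.
  apply: smallest_sub; first exact: sigma_algebra_measurable.
  case: n f mf => [|n] f mf; first by rewrite big_ord0.
  rewrite -bigcup_mkord_ord; apply: bigcup_sub => i Ii.
  by move=> A [B mB <-]; exact: mf.
rewrite (g_sigma_preimage_comp (fun (i : 'I_n) (x : 'rV[T]_n) => x ord0 i) f).
by move=> + _ A mA; apply; exists A.
Qed.

End measurable_row_theory.

Section lebesgue_row.
Variable R : realType.

Definition rcons_row n (p : 'rV[R]_n * R) : 'rV[R]_n.+1 :=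
  \row_i (if unlift ord_max i is Some j then p.1 ord0 j else p.2).

Lemma measurable_rcons_row n : measurable_fun setT (@rcons_row n).
Proof.
apply: measurable_fun_row => i.
case E : (unlift ord_max i) => [j|].
  rewrite (_ : (fun _ => _) = (fun x : 'rV[R]_n => x ord0 j) \o fst).
    by apply: measurableT_comp => //; exact: measurable_coord.
  by apply/funext => p; rewrite mxE E.
rewrite (_ : (fun _ => _) = snd); first exact: measurable_snd.
by apply/funext => p; rewrite mxE E.
Qed.

Section step.
Variables (n : nat) (mu : {measure set 'rV[R]_n -> \bar R}).

Definition lebesgue_step : set 'rV[R]_n.+1 -> \bar R :=
  pushforward (mu \x lebesgue_measure)%E (@rcons_row n).

Let mrcons := @measurable_rcons_row n.

Let step0 : lebesgue_step set0 = 0%E.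
Proof. exact: (measure0 (pushforward _ _)). Qed.

Let step_ge0 A : (0 <= lebesgue_step A)%E.
Proof. exact: (measure_ge0 (pushforward _ _)). Qed.

Let step_sigma_additive : semi_sigma_additive lebesgue_step.
Proof. exact: (@measure_semi_sigma_additive _ _ _ (pushforward _ _)). Qed.

HB.instance Definition _ :=
  isMeasure.Build _ _ _ lebesgue_step step0 step_ge0 step_sigma_additive.

End step.

Fixpoint lebesgue_row n : {measure set 'rV[R]_n -> \bar R} :=
  if n is m.+1 then lebesgue_step (lebesgue_row m) else \d_(0 : 'rV[R]_0).

End lebesgue_row.

Section lebesgue_row_box.
Variable R : realType.

Lemma lebesgue_row_box n (A : 'I_n -> set R) :
  (forall i, measurable (A i)) ->
  lebesgue_row R n [set x | forall i, A i (x ord0 i)] =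
  (\prod_(i < n) lebesgue_measure (A i))%E.
Proof.
elim: n A => [|n IH] A mA.
  rewrite big_ord0 /= diracE mem_set//= => -[].
  by [].
rewrite big_ord_recr/= /lebesgue_step /pushforward.
pose B := [set x : 'rV[R]_n | forall i, A (widen_ord (leqnSn n) i) (x ord0 i)].
have mB : measurable B.
  rewrite (_ : B = \bigcap_(i in [set: 'I_n])
      ((fun x : 'rV[R]_n => x ord0 i) @^-1` A (widen_ord (leqnSn n) i))).
    apply: fin_bigcap_measurable => [|i _]; first exact: finite_finset.
    rewrite -[X in measurable X]setTI.
    exact: measurable_coord.
  by apply/seteqP; split=> x /= h i => [_|]; exact: h.
rewrite (_ : _ @^-1` _ = B `*` A ord_max).
  transitivity (lebesgue_row R n B * lebesgue_measure (A ord_max))%E.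
    by apply: product_measure1E => //; exact: mA.
  congr (_ * _)%E.
  by apply: (IH (fun i => A (widen_ord (leqnSn n) i))) => i; exact: mA.
apply/seteqP; split=> -[x y] /=.
  move=> h; split=> [i /=|].
    have := h (lift ord_max i); rewrite mxE liftK /=.
    congr (A _ _); apply/val_inj => /=; exact: lift_max.
  by have := h ord_max; rewrite mxE unlift_none.
move=> [hx hy] i; rewrite mxE; case: unliftP => [j|] ->//=.
rewrite (_ : lift _ _ = widen_ord (leqnSn n) j)//.
by apply/val_inj => /=; exact: lift_max.
Qed.

End lebesgue_row_box.

Section mixed_derivatives.
Variables (R : realType) (d : nat).
Implicit Types (g : 'rV[R]_d -> R) (s : seq 'I_d) (u : {set 'I_d}).

Definition enorm (x : 'rV[R]_d) : R := Num.sqrt (\sum_i x ord0 i ^+ 2).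

Definition basis_vec (j : 'I_d) : 'rV[R]_d := delta_mx ord0 j.

(* iter_partial [:: j1; ...; jk] g is D_j1 (... (D_jk g)). *)
Fixpoint iter_partial s g : 'rV[R]_d -> R :=
  if s is j :: s' then fun x => 'D_(basis_vec j) (iter_partial s' g) x else g.

Fixpoint iter_derivable s g : Prop :=
  if s is j :: s' then iter_derivable s' g /\
    forall x, derivable (iter_partial s' g) x (basis_vec j)
  else True.

(* enum u lists u in increasing order. On class_S this choice is immaterial:
   when all the mixed partials in this order exist and are continuous, g is a
   sum of iterated integrals of them over boxes, so the mixed partials in every
   other order exist too and have the same values. *)
Definition mixed_partial u g : 'rV[R]_d -> R := iter_partial (enum u) g.

Definition class_S g : Prop :=
  forall u, iter_derivable (enum u) g /\ continuous (mixed_partial u g).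

End mixed_derivatives.

Section densities.
Variables (R : realType) (d : nat).
Implicit Types (q : 'I_d -> R -> R).

Definition is_positive_density (p : R -> R) : Prop :=
  [/\ measurable_fun [set: R] p, forall x, 0 < p x &
      (\int[lebesgue_measure]_x (p x)%:E = 1)%E].

Definition prod_density q (x : 'rV[R]_d) : R := \prod_j q j (x ord0 j).

Definition std_normal_density : 'rV[R]_d -> R :=
  prod_density (fun _ => normal_pdf 0 1).

Definition has_density d' (T : measurableType d') (P : probability T R)
    (X : {RV P >-> 'rV[R]_d}) (p : 'rV[R]_d -> R) : Prop :=
  forall A : set 'rV[R]_d, measurable A ->
    (distribution P X A = \int[lebesgue_row R d]_(x in A) (p x)%:E)%E.

(* E_q[g(X)] *)
Definition density_expectation q (g : 'rV[R]_d -> R) : \bar R :=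
  (\int[lebesgue_row R d]_x (g x * prod_density q x)%:E)%E.

Definition density_cdf (p : R -> R) (x : R) : R :=
  (\int[lebesgue_measure]_(t in `]-oo, x]) p t)%R.

(* For a positive density the cdf is a bijection of R onto ]0, 1[; the inverse
   takes the junk value 0 outside ]0, 1[, in particular at 0, which a uniformly
   distributed point hits with probability 0. *)
Definition inv_cdf (p : R -> R) : R -> R := pinv [set: R] (density_cdf p).

Definition inv_cdf_row q (y : 'rV[R]_d) : 'rV[R]_d :=
  \row_j inv_cdf (q j) (y ord0 j).

End densities.

Section rqmc.
Variables (R : realType) (d : nat).

Definition unit_cube : set 'rV[R]_d :=
  [set x | forall i, 0 <= x ord0 i < 1].

Definition star_discrepancy n (y : 'I_n -> 'rV[R]_d) : R :=
  sup [set `| #|[pred j | [forall i, 0 <= y j ord0 i < a ord0 i]]|%:R / n%:R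
               - \prod_i a ord0 i |
      | a in [set a : 'rV[R]_d | forall i, 0 <= a ord0 i <= 1]].

(* The discrepancy bound is required from n = 2 on: at n = 1 its right-hand
   side is 0 when d >= 2, and no point set satisfies it. *)
Definition is_rqmc d' (T : measurableType d') (P : probability T R)
    (y : forall n, 'I_n -> {RV P >-> 'rV[R]_d}) : Prop :=
  [/\ forall n (j : 'I_n) w, unit_cube (y n j w),
      forall n (j : 'I_n), has_density (y n j) \1_unit_cube &
      exists C' : R, forall n, (1 < n)%N ->
        {ae P, forall w, star_discrepancy (fun j => y n j w)
                         <= C' * ln n%:R ^+ d.-1 / n%:R}].

Definition f_IS (q : 'I_d -> R -> R) (f : 'rV[R]_d -> R) (x : 'rV[R]_d) : R :=
  std_normal_density x * f x / prod_density q x.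

Definition IS_estimator (q : 'I_d -> R -> R) (f : 'rV[R]_d -> R)
    n (y : 'I_n -> 'rV[R]_d) : R :=
  n%:R^-1 * \sum_j f_IS q f (inv_cdf_row q (y j)).

(* E[(I_n^IS(f) - E[f(X)])^2], in the extended reals so that an infinite
   expectation is not silently replaced by a finite value. *)
Definition IS_mse (q : 'I_d -> R -> R) (f : 'rV[R]_d -> R)
    d1 (T : measurableType d1) (P : probability T R)
    (y : forall n, 'I_n -> {RV P >-> 'rV[R]_d})
    d2 (T' : measurableType d2) (P' : probability T' R)
    (X : {RV P' >-> 'rV[R]_d}) (n : nat) : \bar R :=
  (\int[P]_w ((IS_estimator q f (fun j => y n j w))%:E
              - 'E_P'[f \o X]) ^+ 2)%E.

Definition ereal_bigO (u : nat -> \bar R) (v : nat -> R) : Prop :=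
  exists K : R, \forall n \near \oo, (u n <= (K * v n)%:E)%E.

End rqmc.

(* Main.v *)
Require Import Defs.
From HB Require Import structures.
From mathcomp Require Import all_boot all_order all_algebra.
From mathcomp Require Import all_classical all_reals all_analysis.
From mathcomp Require Import measurable_realfun.
From mathcomp Require Import ring lra zify.

Set Implicit Arguments.
Unset Strict Implicit.
Unset Printing Implicit Defensive.

Import Order.TTheory GRing.Theory Num.Theory.
Import numFieldNormedType.Exports.

Local Open Scope classical_set_scope.
Local Open Scope ring_scope.

(** Put [h = f / q] and [F = phi * h]. The points [x_j = G^-1 (y_j)] have law [q]
    ([inv_law]), and the target [E[f(X)]] is the integral of [F] against [q]
    ([target_expectation]), so the error is that of the average of the
    [F (x_j)].

    Let [g] be [F] multiplied in each variable by a continuously differentiable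
    cutoff that is 1 on [[1 - r, r - 1]] and 0 outside [[-r, r]]. As [g] has
    compact support, [g x] is up to sign the integral over [t > x] of the mixed
    derivative of [g] in all the variables. The error of the average of the
    [g (x_j)] is therefore the integral of that derivative against the local
    discrepancies of the orthants, and these are local discrepancies of the
    [y_j]. The error is at most [D * (2 * r) ^ d * S], where [D] is the star
    discrepancy and [S] bounds the mixed derivative ([koksma_hlawka]).

    The representation is used in a discrete form ([grid_expansion]): on a grid,
    [g] is a combination of indicators of orthants with the mixed differences of
    [g] as coefficients, and the mean value theorem bounds these differences.
    Hence only the existence of the iterated derivatives and the continuity of
    [g] matter, and no integral of a derivative appears. The same
    approximation shows that [F] is measurable. The bound [S] comes from the
    growth of the mixed derivatives of [h] by the Leibniz formula
    ([norm_leibniz_le]), since the Gaussian weight is a product.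

    The remainder [F - g] vanishes where [|x| < r - 1]. As each [x_j] has law
    [q], its share of the mean square error is controlled by its second moment
    under [q], whatever the dependence between the points ([IS_mse_le]).

    It remains to choose [r]. For [A < 1/2], [S] is bounded independently of [r],
    and with [r] of order [sqrt (ln n)] the remainder is [O (1 / n)] uniformly
    ([IS_mse_subcritical]). For [A = 1/2], [S] is of order
    [r ^ d * exp (B * sqrt d * r)], and the choice [beta * r ^ gamma = 2 * ln n]
    makes the second moment of the remainder [O (r ^ alpha / n ^ 2)]
    ([IS_mse_critical]). *)

(** * Partial derivatives along one coordinate *)

Section one_coordinate.
Context (R : realType) (d : nat).
Implicit Types (x : 'rV[R]_d) (i j : 'I_d) (s t : R).

(** The point [x] with its [j]-th coordinate replaced by [t]. *)
Definition upd x j t : 'rV[R]_d := \row_i (if i == j then t else x ord0 i).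

Lemma updE x j t i : upd x j t ord0 i = if i == j then t else x ord0 i.
Proof. by rewrite mxE. Qed.

Lemma upd_eq x j t : upd x j t ord0 j = t.
Proof. by rewrite updE eqxx. Qed.

Lemma upd_neq x j t i : i != j -> upd x j t ord0 i = x ord0 i.
Proof. by rewrite updE => /negPf ->. Qed.

Lemma upd_id x j : upd x j (x ord0 j) = x.
Proof. by apply/rowP => i; rewrite updE; case: eqP => [->|]. Qed.

Lemma basis_vecD_upd x j h t : h *: basis_vec R j + upd x j t = upd x j (h + t).
Proof.
apply/rowP => i; rewrite !mxE eqxx /=; case: eqP => _.
  by rewrite mulr1.
by rewrite mulr0 add0r.
Qed.

Lemma basis_vecD_upd_neq x i j h t : i != j ->
  h *: basis_vec R i + upd x j t = upd (h *: basis_vec R i + x) j t.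
Proof.
move=> ij; apply/rowP => k; rewrite !mxE eqxx /=.
have [->|//] := eqVneq k j.
by rewrite (negPf (_ : j != i)) ?mulr0 ?add0r// eq_sym.
Qed.

Let quot_upd (w : 'rV[R]_d -> R) x j t :
  (fun h : R => h^-1 *: ((w \o shift (upd x j t)) (h *: basis_vec R j) - w (upd x j t)))
  = (fun h : R => h^-1 *: (((fun s => w (upd x j s)) \o shift t) (h *: (1 : R)) - w
    (upd x j t))).
Proof.
by apply/funext => h /=; rewrite basis_vecD_upd /GRing.scale /= mulr1.
Qed.

Let quot_comp_upd (w : 'rV[R]_d -> R) x i j t : i != j ->
  (fun h : R => h^-1 *: (((fun z => w (upd z j t)) \o shift x) (h *: basis_vec R i) -
    w (upd x j t)))
  = (fun h : R => h^-1 *: ((w \o shift (upd x j t)) (h *: basis_vec R i) - w (upd x j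
    t))).
Proof. by move=> ij; apply/funext => h /=; rewrite -basis_vecD_upd_neq. Qed.

Lemma derive_upd (w : 'rV[R]_d -> R) x j t :
  'D_(basis_vec R j) w (upd x j t) = 'D_1 (fun s => w (upd x j s)) t.
Proof. by rewrite /derive quot_upd. Qed.

Lemma derivable_upd (w : 'rV[R]_d -> R) x j t :
  derivable w (upd x j t) (basis_vec R j) =
  derivable (fun s => w (upd x j s)) t 1.
Proof. by rewrite /derivable quot_upd. Qed.

Lemma is_derive_upd (w : 'rV[R]_d -> R) x j t l :
  is_derive t 1 (fun s => w (upd x j s)) l ->
  is_derive (upd x j t) (basis_vec R j) w l.
Proof.
case=> h1 h2; split; first by rewrite derivable_upd.
by rewrite derive_upd.
Qed.

Lemma derive_comp_upd (w : 'rV[R]_d -> R) x i j t : i != j ->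
  'D_(basis_vec R i) (fun z => w (upd z j t)) x = 'D_(basis_vec R i) w (upd x j t).
Proof. by move=> ij; rewrite /derive quot_comp_upd. Qed.

Lemma derivable_comp_upd (w : 'rV[R]_d -> R) x i j t : i != j ->
  derivable (fun z => w (upd z j t)) x (basis_vec R i) =
  derivable w (upd x j t) (basis_vec R i).
Proof. by move=> ij; rewrite /derivable quot_comp_upd. Qed.

Lemma iter_partial_comp_upd (s : seq 'I_d) (w : 'rV[R]_d -> R) j t :
  j \notin s ->
  iter_partial s (fun z => w (upd z j t)) = fun z => iter_partial s w (upd z j t).
Proof.
elim: s => [//|i s IH]; rewrite inE negb_or => /andP[ji js] /=.
by apply/funext => x; rewrite IH// derive_comp_upd// eq_sym.
Qed.

Lemma iter_derivable_comp_upd (s : seq 'I_d) (w : 'rV[R]_d -> R) j t :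
  j \notin s -> iter_derivable s w ->
  iter_derivable s (fun z => w (upd z j t)).
Proof.
elim: s => [//|i s IH]; rewrite inE negb_or => /andP[ji js] /= [h1 h2].
split; first exact: IH.
by move=> x; rewrite iter_partial_comp_upd// derivable_comp_upd// eq_sym.
Qed.

Lemma iter_partialB (s : seq 'I_d) (v w : 'rV[R]_d -> R) :
  iter_derivable s v -> iter_derivable s w ->
  iter_derivable s (fun z => v z - w z) /\
  iter_partial s (fun z => v z - w z) = fun z => iter_partial s v z - iter_partial s w z.
Proof.
elim: s => [//|i s IH] /= [v1 v2] [w1 w2].
have [h1 h2] := IH v1 w1; split.
  by split=> [//|x]; rewrite h2; exact: (derivableB (v2 x) (w2 x)).
by apply/funext => x; rewrite h2; exact: (deriveB (v2 x) (w2 x)).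
Qed.

(** Mean value theorem along a coordinate axis. *)
Lemma partial_MVT (w : 'rV[R]_d -> R) j x a b : a < b ->
  (forall z, derivable w z (basis_vec R j)) ->
  exists c, w (upd x j b) - w (upd x j a) =
    'D_(basis_vec R j) w (upd x j c) * (b - a).
Proof.
move=> ab dw.
have dv s : is_derive s 1 (fun s => w (upd x j s)) ('D_(basis_vec R j) w (upd x j s)).
  by rewrite derive_upd; apply/derivableP; rewrite -derivable_upd.
have [|c _ ->] := @MVT R _ _ a b ab (fun s _ => dv s).
  apply: continuous_subspaceT => s; apply/differentiable_continuous.
  by apply/derivable1_diffP; case: (dv s).
by exists c.
Qed.

End one_coordinate.

(** * Summation by parts on a grid *)

Section grid.
Context (R : realType) (M : R) (N : nat).
Hypotheses (M_gt0 : 0 < M) (N_gt0 : (0 < N)%N).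

(** A grid of [N + 1] points on [[-M, M]]. *)
Definition grid_step : R := 2 * M / N%:R.

Definition grid_point (k : nat) : R := - M + k%:R * grid_step.

(** Number of grid points among the first [n] that are at most [t]. *)
Definition grid_index n (t : R) : nat := (\sum_(k < n) (grid_point k <= t)%R)%N.

(** The smallest grid point above [t], clipped to [[-M, M]]. *)
Definition grid_corner (t : R) : R := grid_point (grid_index N t).

Lemma grid_step_gt0 : 0 < grid_step.
Proof. by rewrite /grid_step divr_gt0 ?mulr_gt0// ltr0n. Qed.

Lemma grid_pointS k : grid_point k.+1 = grid_point k + grid_step.
Proof. by rewrite /grid_point -natr1; ring. Qed.

Lemma grid_point_lt k : grid_point k < grid_point k.+1.
Proof. by rewrite grid_pointS ltrDl grid_step_gt0. Qed.

Lemma grid_point_homo k l : (k <= l)%N -> grid_point k <= grid_point l.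
Proof.
move=> kl; rewrite lerD2l ler_wpM2r ?ler_nat//; exact: ltW grid_step_gt0.
Qed.

Lemma grid_point0 : grid_point 0 = - M.
Proof. by rewrite /grid_point mul0r addr0. Qed.

Lemma grid_pointN : grid_point N = M.
Proof.
rewrite /grid_point /grid_step mulrCA divff ?mulr1; first by ring.
by rewrite pnatr_eq0 -lt0n.
Qed.

Lemma grid_indexS_lt n t : t < grid_point n -> grid_index n.+1 t = grid_index n t.
Proof. by move=> h; rewrite /grid_index big_ord_recr /= leNgt h /= addn0. Qed.

Lemma grid_index_ge n t : grid_point n <= t -> grid_index n.+1 t = n.+1.
Proof.
move=> h; rewrite /grid_index (eq_bigr (fun=> 1%N)).
  by rewrite sum_nat_const card_ord muln1.
move=> k _; rewrite (le_trans _ h)// grid_point_homo//.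
by rewrite -ltnS.
Qed.

(** Summation by parts: the increments of [phi] to the right of [t] add up. *)
Lemma grid_telescope n t (phi : nat -> R) :
  phi (grid_index n t) =
  \sum_(k < n) (t < grid_point k)%R%:R * (phi k - phi k.+1) + phi n.
Proof.
elim: n => [|n IH]; first by rewrite /grid_index !big_ord0 add0r.
rewrite big_ord_recr /=; have [h|h] := ltP t (grid_point n).
  by rewrite grid_indexS_lt// IH mul1r; ring.
rewrite grid_index_ge// mul0r addr0 big1 ?add0r// => k _.
rewrite ltNge (le_trans _ h) ?mul0r//; apply: grid_point_homo; exact: ltnW.
Qed.

Lemma grid_index_bracket n t : - M <= t -> t < grid_point n ->
  t < grid_point (grid_index n t) <= t + grid_step.
Proof.
move=> Mt; elim: n => [|n IH] h; first by move: h; rewrite grid_point0 ltNge Mt.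
have [h'|h'] := ltP t (grid_point n); first by rewrite grid_indexS_lt// IH.
by rewrite grid_index_ge// h grid_pointS lerD2r h'.
Qed.

Lemma grid_corner_bracket t : - M <= t < M ->
  t < grid_corner t <= t + grid_step.
Proof.
by move=> /andP[h1 h2]; apply: grid_index_bracket => //; rewrite grid_pointN.
Qed.

Lemma grid_corner_ge t : M <= t -> grid_corner t = M.
Proof.
move=> h; have NE : grid_index N t = N.
  rewrite -(prednK N_gt0); apply: grid_index_ge; apply: le_trans h.
  by rewrite -grid_pointN; apply: grid_point_homo; rewrite leq_pred.
by rewrite /grid_corner NE grid_pointN.
Qed.

(** The grid corner above a point, coordinate by coordinate. *)
Definition grid_row d (x : 'rV[R]_d) : 'rV[R]_d := \row_i grid_corner (x ord0 i).

(** A function whose mixed derivative is bounded by [S] is, on the grid, a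
    combination of indicators of orthants whose coefficients are the mixed
    differences of the function over the grid cells. Each coordinate costs one
    summation by parts, and the mean value theorem bounds the differences. *)
Lemma grid_expansion d (s : seq 'I_d) (u : 'rV[R]_d -> R) (S : R) :
  uniq s ->
  (forall x x' : 'rV[R]_d, (forall i, i \in s -> x ord0 i = x' ord0 i) -> u x = u x') ->
  iter_derivable s u ->
  (forall x, `|iter_partial s u x| <= S) ->
  (forall (x : 'rV[R]_d) i, i \in s -> x ord0 i = M -> u x = 0) ->
  exists L : seq (R * 'rV[R]_d),
    (forall x, u (grid_row x) =
      \sum_(p <- L) p.1 * \prod_(i <- s) (x ord0 i < p.2 ord0 i)%R%:R) /\
    \sum_(p <- L) `|p.1| <= (2 * M) ^+ size s * S.
Proof.
elim: s u S => [|j s IH] u S.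
  move=> _ uE _ uS _; exists [:: (u 0, 0)]; split => [x|].
    by rewrite big_seq1 /= big_nil mulr1; apply: uE.
  by rewrite big_seq1 /= expr0 mul1r; exact: uS.
rewrite cons_uniq => /andP[js us] uE [du dju] uS uM.
(* The difference [v k] no longer depends on the coordinate [j], and its mixed
   derivative along [s] is at most [S * grid_step]. *)
pose v k := fun x => u (upd x j (grid_point k)) - u (upd x j (grid_point k.+1)).
have dv k : iter_derivable s (v k) /\ iter_partial s (v k) =
    fun z => iter_partial s u (upd z j (grid_point k)) -
             iter_partial s u (upd z j (grid_point k.+1)).
  have [h1 h2] := iter_partialB (iter_derivable_comp_upd (grid_point k) js du)
    (iter_derivable_comp_upd (grid_point k.+1) js du).
  by split=> //; rewrite h2 !iter_partial_comp_upd.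
have /choice[L HL] : forall k, exists L : seq (R * 'rV[R]_d),
    (forall x, v k (grid_row x) =
      \sum_(p <- L) p.1 * \prod_(i <- s) (x ord0 i < p.2 ord0 i)%R%:R) /\
    \sum_(p <- L) `|p.1| <= (2 * M) ^+ size s * (S * grid_step).
  move=> k; apply: IH => //.
  - move=> x x' xx'; congr (_ - _); apply: uE => i; rewrite inE !updE;
      by case: eqP => //= _; exact: xx'.
  - by case: (dv k).
  - move=> x; case: (dv k) => _ ->; rewrite distrC.
    have [c ->] := partial_MVT x (grid_point_lt k) dju.
    rewrite grid_pointS addrAC subrr add0r normrM (gtr0_norm grid_step_gt0).
    by rewrite ler_pM2r ?grid_step_gt0//; exact: uS.
  - move=> x i si xi; rewrite /v !(uM _ i) ?subrr ?inE ?si ?orbT//;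
      by rewrite upd_neq//; apply: contraNneq js => <-.
exists [seq (p.1, upd p.2 j (grid_point k)) | k <- iota 0 N, p <- L k]; split.
  move=> x; rewrite big_allpairs_dep /= -{1}(upd_id (grid_row x) j) mxE.
  rewrite (grid_telescope _ _ (fun k => u (upd (grid_row x) j (grid_point k)))).
  rewrite [X in _ + X](uM _ j) ?inE ?eqxx// ?upd_eq ?grid_pointN// addr0.
  rewrite -(big_mkord xpredT (fun k => (x ord0 j < grid_point k)%R%:R *
     (u (upd (grid_row x) j (grid_point k)) -
      u (upd (grid_row x) j (grid_point k.+1))))) /index_iota subn0.
  apply: eq_bigr => k _; case: (HL k) => + _ => /(_ x); rewrite /v => ->.
  rewrite big_distrr /=; apply: eq_bigr => p _.
  rewrite big_cons upd_eq mulrCA; congr (_ * (_ * _)).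
  rewrite !big_seq; apply: eq_bigr => i si; rewrite upd_neq//.
  by apply: contraNneq js => <-.
rewrite big_allpairs_dep /=.
apply: (@le_trans _ _ (\sum_(k <- iota 0 N) (2 * M) ^+ size s * (S * grid_step))).
  by apply: ler_sum => k _; case: (HL k).
rewrite big_const_seq count_predT size_iota iter_addr_0 -[_ *+ N]mulr_natr.
rewrite [X in _ <= X](_ : _ = (2 * M) ^+ size s * (S * grid_step) * N%:R)//=.
rewrite exprS {1}(_ : 2 * M = grid_step * N%:R); first by ring.
by rewrite /grid_step mulfVK// pnatr_eq0 -lt0n.
Qed.

End grid.

(** * Leibniz formula for mixed derivatives of a weighted function *)

Section leibniz.
Context (R : realType) (d : nat).
Implicit Types (x : 'rV[R]_d).

(** All the sublists of a list, with the order kept. *)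
Fixpoint sublists (T : Type) (s : seq T) : seq (seq T) :=
  if s is j :: s' then [seq j :: v | v <- sublists s'] ++ sublists s'
  else [:: [::]].

Lemma size_sublists (T : Type) (s : seq T) : size (sublists s) = (2 ^ size s)%N.
Proof.
by elim: s => [//|j s IH] /=; rewrite size_cat size_map IH expnS mul2n addnn.
Qed.

Lemma sublists_subseq (T : eqType) (s v : seq T) : v \in sublists s -> subseq v s.
Proof.
elim: s v => [|j s IH] v; first by rewrite inE => /eqP ->.
rewrite mem_cat => /orP[/mapP[w /IH ws ->]|/IH vs]; first by rewrite /= eqxx.
exact: subseq_trans vs (subseq_cons s j).
Qed.

(** A sublist of the increasing enumeration of all coordinates is the
    increasing enumeration of a set of coordinates. *)
Lemma sublist_enum_set (v : seq 'I_d) : v \in sublists (enum 'I_d) ->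
  v = enum [set i in v].
Proof.
move/sublists_subseq => /subseq_uniqP -/(_ (enum_uniq _)) {1}->.
rewrite enumT /enum_mem; apply: eq_filter => i.
by rewrite /= inE.
Qed.

Lemma is_derive_sum_seq (I : eqType) (r : seq I) (F : I -> 'rV[R]_d -> R) (F' : I -> R)
    x e :
  (forall k, k \in r -> is_derive x e (F k) (F' k)) ->
  is_derive x e (fun z => \sum_(k <- r) F k z) (\sum_(k <- r) F' k).
Proof.
elim: r => [|k r IH] H.
  rewrite big_nil (_ : (fun _ => _) = cst 0); first exact: is_derive_cst.
  by apply/funext => z; rewrite big_nil.
rewrite big_cons (_ : (fun _ => _) = F k \+ (fun z => \sum_(l <- r) F l z)).
  apply: is_deriveD; first by apply: H; rewrite mem_head.
  by apply: IH => l lr; apply: H; rewrite inE lr orbT.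
by apply/funext => z; rewrite big_cons.
Qed.

Variables (h : 'rV[R]_d -> R) (psi dpsi : R -> R).
Hypothesis psi_derive : forall t : R, is_derive t 1 psi (dpsi t).

(** Summand of the Leibniz formula in which the derivatives along [v] fall on
    [h] and the other derivatives along [s] fall on the product weight. *)
Definition leibniz_term (s v : seq 'I_d) x : R :=
  iter_partial v h x *
  \prod_i (if (i \in s) && (i \notin v) then dpsi (x ord0 i) else psi (x ord0 i)).

Lemma is_derive_leibniz_term (s v : seq 'I_d) j x : j \notin s -> subseq v s ->
  (forall z, derivable (iter_partial v h) z (basis_vec R j)) ->
  is_derive x (basis_vec R j) (leibniz_term s v)
    (leibniz_term (j :: s) (j :: v) x + leibniz_term (j :: s) v x).
Proof.
move=> js vs dv; have jv : j \notin v by apply: contra js => /(mem_subseq vs).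
rewrite -{1}(upd_id x j); apply: is_derive_upd; set t := x ord0 j.
pose K := \prod_(i | i != j)
  (if (i \in s) && (i \notin v) then dpsi (x ord0 i) else psi (x ord0 i)).
pose H := fun r => iter_partial v h (upd x j r).
have dH : is_derive t 1 H ('D_(basis_vec R j) (iter_partial v h) x).
  rewrite -{1}(upd_id x j) derive_upd; apply/derivableP.
  by rewrite -derivable_upd.
rewrite (_ : (fun r => _) = (H * psi) * cst K); last first.
  apply/funext => r; rewrite /leibniz_term /= (bigD1 j)//= upd_eq (negPf js) /=.
  rewrite mulrA; congr (_ * _); apply: eq_bigr => i ij.
  by rewrite upd_neq.
have Hpsi := is_deriveM dH (psi_derive t).
apply: is_derive_eq (is_deriveM Hpsi (is_derive_cst K t 1)) _.
have E1 : leibniz_term (j :: s) (j :: v) x =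
    'D_(basis_vec R j) (iter_partial v h) x * (psi t * K).
  rewrite /leibniz_term (bigD1 j)//= !inE eqxx /=; congr (_ * (_ * _)).
  by apply: eq_bigr => i ij; rewrite !inE (negPf ij).
have E2 : leibniz_term (j :: s) v x = iter_partial v h x * (dpsi t * K).
  rewrite /leibniz_term (bigD1 j)//= !inE eqxx jv /=; congr (_ * (_ * _)).
  by apply: eq_bigr => i ij; rewrite !inE (negPf ij).
rewrite E1 E2 /H upd_id /GRing.scale /= mulr0 add0r; ring.
Qed.

(** Leibniz formula for a product weight. *)
Lemma iter_partial_leibniz (s : seq 'I_d) : uniq s ->
  (forall v, v \in sublists s -> iter_derivable v h) ->
  let u := fun x => h x * \prod_i psi (x ord0 i) in
  iter_derivable s u /\
  iter_partial s u = fun x => \sum_(v <- sublists s) leibniz_term s v x.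
Proof.
move=> + + u; elim: s => [|j s IH].
  by move=> _ _; split=> //; apply/funext => x; rewrite big_seq1.
rewrite cons_uniq => /andP[js us] H.
have [|h1 h2] := IH us.
  by move=> v vs; apply: H; rewrite /= mem_cat vs orbT.
have dF x : is_derive x (basis_vec R j) (iter_partial s u)
  (\sum_(v <- sublists s) (leibniz_term (j :: s) (j :: v) x + leibniz_term (j :: s) v x)).
  rewrite h2; apply: is_derive_sum_seq => v vs.
  apply: is_derive_leibniz_term => //; first exact: sublists_subseq.
  have : j :: v \in sublists (j :: s) by rewrite /= mem_cat map_f.
  by move/H => -[].
split; first by split=> // x; case: (dF x).
apply/funext => x /=; rewrite derive_val.
by rewrite big_cat big_map /= big_split.
Qed.

(** If [B] bounds all the mixed derivatives of [h] at [x] and [P] bounds both the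
    weight and its derivative, all the [2 ^ size s] terms have the same bound. *)
Lemma norm_leibniz_le (s : seq 'I_d) x (B : R) (P : R -> R) :
  uniq s -> (forall v, v \in sublists s -> iter_derivable v h) ->
  (forall v, v \in sublists s -> `|iter_partial v h x| <= B) ->
  (forall t, `|psi t| <= P t) -> (forall t, `|dpsi t| <= P t) ->
  `|iter_partial s (fun x => h x * \prod_i psi (x ord0 i)) x| <=
    2 ^+ size s * (B * \prod_i P (x ord0 i)).
Proof.
move=> us sd hB p1 p2; have [_ ->] := iter_partial_leibniz us sd.
apply: le_trans (ler_norm_sum _ _ _) _.
apply: (@le_trans _ _ (\sum_(v <- sublists s) (B * \prod_i P (x ord0 i)))).
  rewrite [X in X <= _]big_seq [X in _ <= X]big_seq; apply: ler_sum => v vs;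
    rewrite normrM; apply: ler_pM => //.
    exact: hB.
  rewrite normr_prod; apply: ler_prod => i _; rewrite normr_ge0 /=.
  by case: ifP.
by rewrite big_const_seq count_predT size_sublists iter_addr_0 -[_ *+ (2 ^
  _)]mulr_natl natrX.
Qed.

End leibniz.

(** * A smooth cutoff of the Gaussian weight *)

Section cutoff.
Context (R : realType).
Implicit Types (r s t : R).

(** The square of the positive part. *)
Definition pos_sq t : R := Num.max t 0 ^+ 2.

(* The derivative [2 max(t, 0)] is 2-Lipschitz, so the first order Taylor
   remainder at [t] is at most [h ^ 2], uniformly in [t]. *)
Lemma is_derive_pos_sq t : is_derive t 1 pos_sq (2 * Num.max t 0).
Proof.
have key h : h != 0 ->
    `|2 * Num.max t 0 - h^-1 * (pos_sq (h + t) - pos_sq t)| <= `|h|.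
  move=> h0; rewrite -(ler_pM2r (_ : 0 < `|h|)) ?normr_gt0//.
  rewrite -normrM -normrM mulrBl [h^-1 * _ * h]mulrAC mulVf// mul1r -expr2.
  rewrite [X in _ <= X]ger0_norm ?sqr_ge0// ler_norml /pos_sq.
  by case: (ltP t 0) => ht; case: (ltP (h + t) 0) => hht;
    apply/andP; split; nra.
have H : (fun h => h^-1 *: ((pos_sq \o shift t) (h *: 1) - pos_sq t)) @ 0^'
    --> 2 * Num.max t 0.
  apply/cvgrPdist_le => e e0; near=> h.
  have h0 : h != 0 by near: h; exact: nbhs_dnbhs_neq.
  rewrite /= /GRing.scale /= mulr1; apply: le_trans (key _ h0) _.
  near: h; exact: dnbhs0_le.
split; first by apply/cvg_ex; eexists; exact: H.
by apply: cvg_lim => //; exact: H.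
Unshelve. all: end_near. Qed.

(** A continuously differentiable step, 0 for [t <= 0] and 1 for [t >= 1]. *)
Definition smooth_step t : R :=
  2 * pos_sq t - 4 * pos_sq (t - 2^-1) + 2 * pos_sq (t - 1).

(** The derivative of [smooth_step]. *)
Definition dsmooth_step t : R :=
  4 * Num.max t 0 - 8 * Num.max (t - 2^-1) 0 + 4 * Num.max (t - 1) 0.

Lemma is_derive_smooth_step t : is_derive t 1 smooth_step (dsmooth_step t).
Proof.
have sh c : is_derive t 1 (fun t => pos_sq (t - c)) (2 * Num.max (t - c) 0).
  apply: is_derive_eq (@is_derive1_comp _ pos_sq (fun t => t - c) t
    (2 * Num.max (t - c) 0) 1 (is_derive_pos_sq _) _) _; last by rewrite mulr1.
  by apply: is_derive_eq (is_deriveB (is_derive_id t 1) (is_derive_cst c t 1)) _;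
    rewrite subr0.
have d0 := is_derive_pos_sq t.
rewrite (_ : smooth_step = 2 \*: pos_sq - 4 \*: (fun t => pos_sq (t - 2^-1))
    + 2 \*: (fun t => pos_sq (t - 1))); last exact/funext.
apply: is_derive_eq.
by rewrite /dsmooth_step /GRing.scale /=; ring.
Qed.

Lemma smooth_step_le0 t : t <= 0 -> smooth_step t = 0.
Proof.
move=> t0; rewrite /smooth_step /pos_sq !max_r ?expr0n /=; first by ring.
all: lra.
Qed.

Lemma dsmooth_step_le0 t : t <= 0 -> dsmooth_step t = 0.
Proof.
move=> t0; rewrite /dsmooth_step !max_r; first by ring.
all: lra.
Qed.

Lemma smooth_step_ge1 t : 1 <= t -> smooth_step t = 1.
Proof.
move=> t0; rewrite /smooth_step /pos_sq !max_l; first by field.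
all: lra.
Qed.

Lemma smooth_step_itv t : 0 <= smooth_step t <= 1.
Proof.
have h : (2^-1 : R) * 2 = 1 by rewrite mulVf.
rewrite /smooth_step /pos_sq.
by case: (ltP t 0) => h1; case: (ltP (t - 2^-1) 0) => h2; case: (ltP (t - 1) 0) => h3;
  apply/andP; split; nra.
Qed.

Lemma dsmooth_step_itv t : 0 <= dsmooth_step t <= 2.
Proof.
rewrite /dsmooth_step.
by case: (ltP t 0) => h1; case: (ltP (t - 2^-1) 0) => h2; case: (ltP (t - 1) 0) => h3;
  apply/andP; split; lra.
Qed.

(** A continuously differentiable cutoff, 1 on [[1 - r, r - 1]] and 0 outside
    [[-r, r]]. *)
Definition cutoff r t : R := smooth_step (r - t) * smooth_step (r + t).

(** The derivative of [cutoff]. *)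
Definition dcutoff r t : R :=
  smooth_step (r - t) * dsmooth_step (r + t) - dsmooth_step (r - t) * smooth_step (r + t).

Lemma is_derive_cutoff r t : is_derive t 1 (cutoff r) (dcutoff r t).
Proof.
have d1 : is_derive t 1 (fun t => smooth_step (r - t)) (- dsmooth_step (r - t)).
  apply: is_derive_eq (@is_derive1_comp _ smooth_step (fun t => r - t) t
    (dsmooth_step (r - t)) (-1) (is_derive_smooth_step _) _) _; last by rewrite mulrN1.
  by apply: is_derive_eq (is_deriveB (is_derive_cst r t 1) (is_derive_id t 1)) _;
    rewrite sub0r.
have d2 : is_derive t 1 (fun t => smooth_step (r + t)) (dsmooth_step (r + t)).
  apply: is_derive_eq (@is_derive1_comp _ smooth_step (fun t => r + t) t
    (dsmooth_step (r + t)) 1 (is_derive_smooth_step _) _) _; last by rewrite mulr1.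
  by apply: is_derive_eq (is_deriveD (is_derive_cst r t 1) (is_derive_id t 1)) _;
    rewrite add0r.
apply: is_derive_eq (is_deriveM d1 d2) _.
by rewrite /dcutoff /GRing.scale /=; ring.
Qed.

Lemma cutoff_itv r t : 0 <= cutoff r t <= 1.
Proof.
have /andP[a b] := smooth_step_itv (r - t); have /andP[a' b'] := smooth_step_itv (r + t).
by rewrite mulr_ge0//= mulr_ile1.
Qed.

Lemma cutoff_in r t : `|t| <= r - 1 -> cutoff r t = 1.
Proof.
by rewrite ler_norml => /andP[h1 h2]; rewrite /cutoff !smooth_step_ge1 ?mulr1//; lra.
Qed.

Lemma cutoff_out r t : r <= `|t| -> cutoff r t = 0 /\ dcutoff r t = 0.
Proof.
rewrite /cutoff /dcutoff; have [t0|t0] := leP 0 t => h.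
  have e : r - t <= 0 by move: h; rewrite ger0_norm//; lra.
  by rewrite (smooth_step_le0 e) (dsmooth_step_le0 e) !mul0r subrr.
have e : r + t <= 0 by move: h; rewrite ltr0_norm//; lra.
by rewrite (smooth_step_le0 e) (dsmooth_step_le0 e) !mulr0 subrr.
Qed.

Lemma norm_dcutoff_le r t : `|dcutoff r t| <= 4.
Proof.
have /andP[a b] := smooth_step_itv (r - t); have /andP[a' b'] := smooth_step_itv (r + t).
have /andP[c e] := dsmooth_step_itv (r - t);
  have /andP[c' e'] := dsmooth_step_itv (r + t).
rewrite ler_norml /dcutoff; apply/andP; split; nra.
Qed.

(** The truncated Gaussian weight. *)
Definition cut_gauss r t : R := cutoff r t * normal_pdf 0 1 t.

(** The derivative of [cut_gauss]. *)
Definition dcut_gauss r t : R :=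
  (dcutoff r t - cutoff r t * t) * normal_pdf 0 1 t.

Lemma normal_pdf01E t : normal_pdf 0 1 t = normal_peak 1 * expR (- t ^+ 2 / 2) :> R.
Proof. by rewrite normal_pdfE ?oner_eq0// /normal_fun subr0 expr1n. Qed.

Lemma normal_pdf01_gt0 t : 0 < normal_pdf 0 1 t.
Proof. by rewrite normal_pdf01E mulr_gt0 ?normal_peak_gt0 ?oner_eq0 ?expR_gt0. Qed.

Lemma is_derive_normal_pdf01 t : is_derive t 1 (normal_pdf 0 1) (- t * normal_pdf 0 1 t).
Proof.
have -> : normal_pdf 0 1 = (fun t => normal_peak 1 * expR (- t ^+ 2 / 2)) :> (R -> R).
  by apply/funext => u; rewrite normal_pdf01E.
have d1 : is_derive t 1 (fun t : R => - t ^+ 2 / 2) (- t).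
  rewrite (_ : (fun t => _) = (- (2^-1)) \*: ((@id R) * id)); last first.
    by apply/funext => u; transitivity (- 2^-1 * (u * u)); [field|by []].
  by apply: is_derive_eq; rewrite /GRing.scale /=; field.
have d2 := @is_derive1_comp _ expR (fun t => - t ^+ 2 / 2) t _ _ (is_derive_expR _) d1.
apply: is_derive_eq (is_deriveZ (normal_peak 1) d2) _.
by rewrite /GRing.scale /=; ring.
Qed.

Lemma is_derive_cut_gauss r t : is_derive t 1 (cut_gauss r) (dcut_gauss r t).
Proof.
apply: is_derive_eq (is_deriveM (is_derive_cutoff r t) (is_derive_normal_pdf01 t)) _.
by rewrite /dcut_gauss /GRing.scale /=; ring.
Qed.

(** Common bound for the truncated Gaussian weight and its derivative. *)
Definition cut_gauss_bound r t : R :=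
  if `|t| <= r then (4 + `|t|) * normal_pdf 0 1 t else 0.

Lemma norm_cut_gauss_le r t : `|cut_gauss r t| <= cut_gauss_bound r t.
Proof.
rewrite /cut_gauss_bound /cut_gauss; have [h|h] := leP `|t| r; last first.
  by rewrite (cutoff_out (ltW h)).1 mul0r normr0.
rewrite normrM (gtr0_norm (normal_pdf01_gt0 t)) ler_pM2r ?normal_pdf01_gt0//.
have /andP[a b] := cutoff_itv r t.
by rewrite ger0_norm//; have := normr_ge0 t; lra.
Qed.

Lemma norm_dcut_gauss_le r t : `|dcut_gauss r t| <= cut_gauss_bound r t.
Proof.
rewrite /cut_gauss_bound /dcut_gauss; have [h|h] := leP `|t| r; last first.
  by have [-> ->] := cutoff_out (ltW h); rewrite mul0r subr0 mul0r normr0.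
rewrite normrM (gtr0_norm (normal_pdf01_gt0 t)) ler_pM2r ?normal_pdf01_gt0//.
have /andP[a b] := cutoff_itv r t.
apply: le_trans (ler_normB _ _) _; apply: lerD; first exact: norm_dcutoff_le.
by rewrite normrM ger0_norm// ler_piMl.
Qed.

End cutoff.

(** * Measures with a density, and orthants *)

Section density_measure.
Context d (T : measurableType d) (R : realType).
Variables (mu : {measure set T -> \bar R}) (p : T -> R).

(** The measure with density [p] with respect to [mu]. The proofs are arguments
    so that they are available to the instance of measure. *)
Definition density_measure of measurable_fun setT p & (forall x, 0 <= p x) :
  set T -> \bar R := fun A => (\int[mu]_(x in A) (p x)%:E)%E.

Hypotheses (mp : measurable_fun setT p) (p0 : forall x, 0 <= p x).

Let dm0 : density_measure mp p0 set0 = 0%E.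
Proof. by rewrite /density_measure integral_set0. Qed.

Let dm_ge0 A : (0 <= density_measure mp p0 A)%E.
Proof. by apply: integral_ge0 => x _; rewrite lee_fin. Qed.

Let dm_sigma : semi_sigma_additive (density_measure mp p0).
Proof.
by apply: semi_sigma_additive_nng_induced => //; exact/measurable_EFinP.
Qed.

HB.instance Definition _ :=
  isMeasure.Build _ _ _ (density_measure mp p0) dm0 dm_ge0 dm_sigma.

Import HBNNSimple.

Variable nu : {measure set T -> \bar R}.
Hypothesis nuE : forall A, measurable A -> nu A = (\int[mu]_(x in A) (p x)%:E)%E.

Local Open Scope ereal_scope.

Let integral_density_nnsfun (h : {nnsfun T >-> R}) :
  \int[nu]_x (h x)%:E = \int[mu]_x ((h x)%:E * (p x)%:E).
Proof.
have mI r : measurable (h @^-1` [set r]).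
  exact: measurable_funPTI.
transitivity (\int[mu]_x (\sum_(r \in range h) r%:E * (\1_(h @^-1` [set r]) x)%:E *
  (p x)%:E)).
  rewrite integralT_nnsfun sintegralE.
  rewrite ge0_integral_fsum//; last 2 first.
  - move=> r; apply: emeasurable_funM; last exact/measurable_EFinP.
    apply: emeasurable_funM => //; apply/measurable_EFinP.
    exact: measurable_indic.
  - move=> r x _; rewrite mule_ge0// ?lee_fin//; exact: nnfun_muleindic_ge0.
  apply: eq_fsbigr => r /[!inE] -[t _ tr].
  have r0 : (0 <= r)%R by rewrite -tr.
  under eq_integral do rewrite -muleA.
  rewrite ge0_integralZl//; last 2 first.
  - apply: emeasurable_funM; last exact/measurable_EFinP.
    by apply/measurable_EFinP; exact: measurable_indic.
  - by move=> x _; rewrite mule_ge0// ?lee_fin// indicE.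
  rewrite nuE// integral_mkcond; congr (_ * _); apply: eq_integral => x _.
  by rewrite epatch_indic muleC.
apply: eq_integral => x _; rewrite -ge0_mule_fsuml; last first.
  by move=> r; exact: nnfun_muleindic_ge0.
congr (_ * _); rewrite [in RHS](fimfunE h x) -fsumEFin//.
Qed.

(** Change of variables from a measure to its density, for nonnegative
    integrands. *)
Lemma ge0_integral_density (g : T -> \bar R) :
  measurable_fun setT g -> (forall x, 0 <= g x) ->
  \int[nu]_x g x = \int[mu]_x (g x * (p x)%:E).
Proof.
move=> mg g0; pose h := nnsfun_approx measurableT mg.
have hg x : (h n x)%:E @[n --> \oo] --> g x by exact: cvg_nnsfun_approx.
have ndh x : {homo (fun n => (h n x)%:E) : a b / (a <= b)%N >-> a <= b}.
  by move=> a b ab; rewrite lee_fin; exact/lefP/nd_nnsfun_approx.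
transitivity (limn (fun n => \int[nu]_x (h n x)%:E)).
  rewrite -monotone_convergence//; last 2 first.
  - by move=> n; exact/measurable_EFinP.
  - by move=> n x _; rewrite lee_fin.
  by apply: eq_integral => x _; apply/esym/cvg_lim => //; exact: hg.
under eq_fun do rewrite integral_density_nnsfun.
rewrite -monotone_convergence//; last 3 first.
- move=> n; apply: emeasurable_funM; first exact/measurable_EFinP.
  exact/measurable_EFinP.
- by move=> n x _; rewrite mule_ge0// lee_fin.
- by move=> x _ a b ab; rewrite lee_wpmul2r ?lee_fin//; exact: ndh.
apply: eq_integral => x _; apply/cvg_lim => //.
by apply: cvgeZr => //; exact: hg.
Qed.

End density_measure.

Section orthants.
Context (R : realType) (d : nat).
Implicit Types (a x : 'rV[R]_d).

(** The open orthant below [a]. *)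
Definition orthant a : set 'rV[R]_d := [set x | forall i, x ord0 i < a ord0 i].

Lemma measurable_orthant a : measurable (orthant a).
Proof.
rewrite (_ : orthant a = \bigcap_(i in [set: 'I_d])
    ((fun x : 'rV[R]_d => x ord0 i) @^-1` `]-oo, a ord0 i[%classic)).
  apply: fin_bigcap_measurable => [|i _]; first exact: finite_finset.
  by rewrite -[X in measurable X]setTI; exact: measurable_coord.
apply/seteqP; split => x /= h i; first by move=> _; rewrite /= in_itv /=; exact: h.
by have := h i Logic.I; rewrite /= in_itv.
Qed.

Lemma orthantI a a' : orthant a `&` orthant a' =
  orthant (\row_i Num.min (a ord0 i) (a' ord0 i)).
Proof.
apply/seteqP; split => x /=.
  by move=> [h h'] i; rewrite mxE lt_min h h'.
by move=> h; split=> i; have := h i; rewrite mxE lt_min => /andP[].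
Qed.

Lemma bigcup_orthant : \bigcup_k orthant (const_mx k%:R) = [set: 'rV[R]_d].
Proof.
apply/seteqP; split => // x _.
exists (\max_(i < d) (Num.truncn (x ord0 i)).+1)%N => //= i; rewrite mxE.
apply: lt_le_trans (truncnS_gt _) _.
by rewrite ler_nat; apply: leq_bigmax.
Qed.

Lemma bigcup_orthant_upd i (b : R) :
  \bigcup_k orthant (\row_j (if j == i then b else k%:R)) =
  [set x : 'rV[R]_d | x ord0 i < b].
Proof.
apply/seteqP; split => x.
  by move=> [k _ /(_ i)]; rewrite mxE eqxx.
move=> xb; exists (\max_(j < d) (Num.truncn (x ord0 j)).+1)%N => //= j; rewrite mxE.
case: eqP => [->//|_].
apply: lt_le_trans (truncnS_gt _) _.
by rewrite ler_nat; apply: leq_bigmax.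
Qed.

(** The orthants generate the sigma-algebra of the coordinates. *)
Lemma measurable_orthantE : measurable = <<s range orthant >>.
Proof.
apply/seteqP; split; last first.
  apply: smallest_sub; first exact: sigma_algebra_measurable.
  by move=> _ [a _ <-]; exact: measurable_orthant.
apply: smallest_sub; first exact: smallest_sigma_algebra.
move=> A; rewrite -bigcup_seq => -[i _ /=].
have := @measurability _ _ (g_sigma_algebraType (range orthant)) (measurableTypeR R)
  setT (fun x : 'rV[R]_d => x ord0 i) (@RGenInftyO.G R) (RGenInftyO.measurableE R).
have HH : preimage_set_system [set: g_sigma_algebraType (range orthant)]
    (fun x : 'rV[R]_d => x ord0 i) (RGenInftyO.G (R:=R)) `<=` measurable.
  move=> _ [_ [b ->] <-]; rewrite setTI.
  rewrite (_ : _ @^-1` _ = [set x : 'rV[R]_d | x ord0 i < b]); last first.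
    by apply/seteqP; split => x /=; rewrite in_itv.
  rewrite -bigcup_orthant_upd; apply: bigcupT_measurable => k.
  by apply: sub_sigma_algebra; eexists.
by move=> /(_ HH) mi [B mB <-]; exact: mi.
Qed.

(** Measures that agree and are finite on the orthants are equal. *)
Lemma orthant_measure_unique (m1 m2 : {measure set 'rV[R]_d -> \bar R}) :
  (forall a, m1 (orthant a) = m2 (orthant a)) -> (forall a, (m1 (orthant a) < +oo)%E) ->
  forall A, measurable A -> m1 A = m2 A.
Proof.
move=> m12 m1oo A mA.
apply: (measure_unique (range orthant) (fun k => orthant (const_mx k%:R))) => //.
- exact: measurable_orthantE.
- by move=> _ _ [a _ <-] [b _ <-]; rewrite orthantI; eexists.
- exact: bigcup_orthant.
- by move=> _ [a _ <-].
Qed.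

End orthants.

(** * Tonelli for products, and distribution functions of positive densities *)

Section tonelli_product.
Context (R : realType).

Lemma measurable_prod_coord n (F : 'I_n -> R -> R) :
  (forall i, measurable_fun setT (F i)) ->
  measurable_fun setT (fun x : 'rV[R]_n => \prod_i F i (x ord0 i)).
Proof.
move=> mF; apply: measurable_prod => i _.
by apply: measurableT_comp => //; exact: measurable_coord.
Qed.

(* Boxes with sides [[-k, k]] have finite measure and exhaust the space. *)
Lemma sigma_finite_lebesgue_row n :
  exists m : {sigma_finite_measure set 'rV[R]_n -> \bar R},
    forall A, m A = lebesgue_row R n A.
Proof.
have sf : sigma_finite setT (lebesgue_row R n).
  pose B (k : nat) : set R := `[- k%:R, k%:R]%classic.
  exists (fun k => [set x : 'rV[R]_n | forall i, B k (x ord0 i)]).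
    apply/seteqP; split => // x _.
    exists (\max_(i < n) (Num.truncn `|x ord0 i|).+1)%N => //= i.
    rewrite /B /= in_itv /= -ler_norml ltW//.
    by apply: lt_le_trans (truncnS_gt _) _; rewrite ler_nat; apply: leq_bigmax.
  move=> k; split; last first.
    rewrite (@lebesgue_row_box R n (fun=> B k)) => [|i]; last exact: measurable_itv.
    rewrite (eq_bigr (fun=> (k%:R - - k%:R)%:E)); last first.
      move=> i _; rewrite /B lebesgue_measure_itv /= lte_fin.
      case: ltP => // h; congr (_%:E).
      by have := ler0n R k; lra.
    by rewrite prodEFin ltry.
  rewrite (_ : [set x | _] = \bigcap_(i in [set: 'I_n])
      ((fun x : 'rV[R]_n => x ord0 i) @^-1` B k)).
    apply: fin_bigcap_measurable => [|i _]; first exact: finite_finset.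
    rewrite -[X in measurable X]setTI; apply: measurable_coord => //.
    exact: measurable_itv.
  by apply/seteqP; split=> x /= h i => [_|]; exact: h.
pose S := isSFinite.Build _ _ _ _ (sfinite_measure_sigma_finite sf).
pose S' := isSigmaFinite.Build _ _ _ _ sf.
pose m := HB.pack_for (SigmaFiniteMeasure.type 'rV[R]_n R)
  (Measure.sort (lebesgue_row R n)) S S'.
by exists m.
Qed.

(** Tonelli's theorem for a product of functions of one coordinate each. *)
Lemma integral_row_prod n (F : 'I_n -> R -> R) :
  (forall i, measurable_fun setT (F i)) -> (forall i t, 0 <= F i t) ->
  (\int[lebesgue_row R n]_x (\prod_i F i (x ord0 i))%:E =
   \prod_(i < n) \int[lebesgue_measure]_t (F i t)%:E)%E.
Proof.
elim: n F => [|n IH] F mF F0.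
  rewrite big_ord0 /= integral_dirac//; last first.
    apply/measurable_EFinP; exact: measurable_prod_coord.
  by rewrite diracT mul1e big_ord0.
pose F' := fun i : 'I_n => F (widen_ord (leqnSn n) i).
have mF' : measurable_fun setT (fun x : 'rV[R]_n => \prod_i F' i (x ord0 i)).
  by apply: measurable_prod_coord => i; exact: mF.
have F'0 (x : 'rV[R]_n) : 0 <= \prod_i F' i (x ord0 i).
  by apply: prodr_ge0 => i _; exact: F0.
pose h := fun z : 'rV[R]_n * R => ((\prod_i F' i (z.1 ord0 i)) * F ord_max z.2)%:E.
transitivity (\int[lebesgue_row R n \x lebesgue_measure]_z h z)%E.
  transitivity (\int[pushforward (lebesgue_row R n \x lebesgue_measure)%E (@rcons_row
    R n)]_x
      (\prod_i F i (x ord0 i))%:E)%E => //.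
  rewrite ge0_integral_pushforward//; last 3 first.
  - exact: measurable_rcons_row.
  - by apply/measurable_EFinP; exact: measurable_prod_coord.
  - by move=> x _; rewrite lee_fin; apply: prodr_ge0.
  apply: eq_integral => -[x t] _ /=; congr (_%:E).
  rewrite big_ord_recr /= mxE unlift_none; congr (_ * _).
  apply: eq_bigr => i _; rewrite mxE.
  have E : widen_ord (leqnSn n) i = lift ord_max i.
    by apply/val_inj => /=; rewrite /bump leqNgt ltn_ord.
  by rewrite [X in unlift _ X]E liftK.
(* Tonelli's theorem is applied to a sigma-finite copy of the measure. *)
have [m mE] := sigma_finite_lebesgue_row n.
transitivity (\int[m \x lebesgue_measure]_z h z)%E.
  by apply: eq_measure_integral => A mA _; rewrite /product_measure1;
    apply: eq_measure_integral => B mB _; exact: esym (mE B).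
rewrite fubini_tonelli1; last 2 first.
- apply/measurable_EFinP; apply: measurable_funM.
    by apply: (measurableT_comp mF'); exact: measurable_fst.
  by apply: measurableT_comp => //; exact: measurable_snd.
- by move=> z; rewrite lee_fin mulr_ge0.
rewrite big_ord_recr /= -(IH F'); last 2 first.
- by move=> i; exact: mF.
- by move=> i t; exact: F0.
rewrite -ge0_integralZr//; last 3 first.
- by apply/measurable_EFinP.
- by move=> x _; rewrite lee_fin.
- by apply: integral_ge0 => t _; rewrite lee_fin.
transitivity (\int[lebesgue_row R n]_x fubini_F lebesgue_measure h x)%E.
  by apply: eq_measure_integral => A _ _; exact: mE.
apply: eq_integral => x _; rewrite /fubini_F /h /=.
under eq_integral do rewrite EFinM.
rewrite ge0_integralZl_EFin//.
by move=> t _; rewrite lee_fin.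
by apply/measurable_EFinP; exact: mF.
Qed.

End tonelli_product.

Section cdf_of_positive_density.
Context (R : realType) (p : R -> R).
Hypothesis hp : is_positive_density p.

Let mp : measurable_fun setT p. Proof. by case: hp. Qed.
Let p_gt0 t : 0 < p t. Proof. by case: hp. Qed.
Let p_ge0 t : 0 <= p t. Proof. exact: ltW. Qed.
Let p1 : (\int[lebesgue_measure]_t (p t)%:E = 1)%E. Proof. by case: hp. Qed.
Let mpE : measurable_fun setT (EFin \o p). Proof. exact/measurable_EFinP. Qed.

Lemma density_integrable D : measurable D ->
  lebesgue_measure.-integrable D (EFin \o p).
Proof.
move=> mD; apply: (integrableS measurableT) => //; apply/integrableP; split => //.
under eq_integral do rewrite gee0_abs ?lee_fin//.
by rewrite p1 ltry.
Qed.

Local Notation G := (density_cdf p).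

Lemma density_cdfE x : (\int[lebesgue_measure]_(t in `]-oo, x]) (p t)%:E = (G x)%:E)%E.
Proof.
rewrite /density_cdf /Rintegral fineK//.
by apply: integrable_fin_num => //; exact: density_integrable.
Qed.

Lemma density_cdf_oE x : (\int[lebesgue_measure]_(t in `]-oo, x[) (p t)%:E = (G x)%:E)%E.
Proof.
rewrite -density_cdfE; apply: integral_itv_bndo_bndc.
exact: measurable_funTS.
Qed.

Lemma density_cdfB a b : a <= b ->
  G b - G a = (\int[lebesgue_measure]_(t in `]a, b]) p t)%R.
Proof.
move=> ab; apply: Rintegral_itvB; last 2 first.
- by [].
- by rewrite bnd_simp.
exact: density_integrable.
Qed.

(** The distribution function increases strictly because the density is
    positive: its increment over a nontrivial interval cannot vanish. *)
Lemma density_cdf_lt a b : a < b -> G a < G b.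
Proof.
move=> ab; rewrite -subr_gt0 density_cdfB ?ltW//.
rewrite lt_neqAle Rintegral_ge0 ?andbT//; apply/eqP => I0.
have := @ae_eq_integral_abs _ _ _ (@lebesgue_measure R) `]a, b]%classic
  (measurable_itv _) (EFin \o p).
have mab : measurable_fun `]a, b]%classic (EFin \o p) by exact: measurable_funTS.
move=> /(_ mab)[+ _]; case.
  under eq_integral do rewrite gee0_abs ?lee_fin//.
  rewrite -[LHS]fineK; first by rewrite -[fine _]I0.
  by apply: integrable_fin_num => //; exact: density_integrable.
move=> N [mN N0 sN].
have : (lebesgue_measure `]a, b]%classic <= lebesgue_measure N)%E.
  apply: le_measure; rewrite ?inE// => t abt; apply: sN => /= /(_ abt) /eqP.
  by rewrite eqe gt_eqF.
by rewrite N0 lebesgue_measure_itv /= lte_fin ab -EFinB lee_fin leNgt subr_gt0 ab.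
Qed.

Lemma density_cdf_mono : {mono G : a b / a <= b}.
Proof. by apply: le_mono => a b; exact: density_cdf_lt. Qed.

Lemma density_cdf_ge0 x : 0 <= G x.
Proof. exact: Rintegral_ge0. Qed.

Lemma density_cdf_gt0 x : 0 < G x.
Proof.
by apply: le_lt_trans (density_cdf_ge0 (x - 1)) _; apply: density_cdf_lt; rewrite gtrBl.
Qed.

Lemma density_cdf_le1 x : G x <= 1.
Proof.
rewrite -lee_fin -density_cdfE -p1; apply: ge0_subset_integral => //.
by move=> t _; rewrite lee_fin.
Qed.

Lemma density_cdf_lt1 x : G x < 1.
Proof.
by apply: lt_le_trans (density_cdf_le1 (x + 1)); apply: density_cdf_lt; rewrite ltrDl.
Qed.


Lemma density_cdf_near1 y : y < 1 -> exists b, y < G b.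
Proof.
move=> y1; pose F (n : nat) : set R := `]-oo, n%:R]%classic.
have FT : \bigcup_n F n = setT.
  apply/seteqP; split => // t _; exists (Num.truncn t).+1 => //=.
  by rewrite /F /= in_itv /= ltW// truncnS_gt.
have H : ((G n%:R)%:E @[n --> \oo] --> 1)%E.
  rewrite -p1 -FT (_ : (fun n => _) = fun n => \int[lebesgue_measure]_(t in F n) (p
    t)%:E)%E; last first.
    by apply/funext => n; rewrite density_cdfE.
  apply: ge0_nondecreasing_set_cvg_integral.
  - move=> m n mn; apply/subsetPset => t; rewrite /F /= !in_itv /= => /le_trans; apply.
    by rewrite ler_nat.
  - by move=> n; exact: measurable_itv.
  - by move=> n; exact: measurable_funTS.
  - by move=> n t _; rewrite lee_fin.
have /fine_cvgP[_ H'] := H.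
have : \forall n \near \oo, y < G n%:R by exact: cvgr_gt H' _ y1.
by case=> n _ /(_ n (leqnn n)) yn; exists n%:R.
Qed.

Lemma density_cdf_near0 y : 0 < y -> exists a, G a < y.
Proof.
move=> y0; pose F (n : nat) : set R := `]- n%:R, +oo[%classic.
have FT : \bigcup_n F n = setT.
  apply/seteqP; split => // t _; exists (Num.truncn (- t)).+1 => //=.
  by rewrite /F /= in_itv /= andbT ltrNl truncnS_gt.
have GF n : (\int[lebesgue_measure]_(t in F n) (p t)%:E = (1 - G (- n%:R))%:E)%E.
  rewrite EFinB -density_cdfE -p1.
  rewrite (_ : [set: R] = `]-oo, - n%:R]%classic `|` F n); last first.
    by apply/seteqP; split => // t _; rewrite /F /= !in_itv /= andbT; case: leP => _;
      [left|right].
  rewrite ge0_integral_setU//=.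
  - by rewrite density_cdfE addeAC subee// add0e.
  - exact: measurable_itv.
  - exact: measurable_funTS.
  - by move=> t _; rewrite lee_fin.
  - apply/disj_setPS => t []; rewrite /F /= !in_itv /= andbT => h1 h2.
    by move: (le_lt_trans h1 h2); rewrite ltxx.
have H : ((1 - G (- n%:R))%:E @[n --> \oo] --> 1)%E.
  rewrite -p1 -FT (_ : (fun n => _) = fun n => \int[lebesgue_measure]_(t in F n) (p
    t)%:E)%E; last first.
    by apply/funext => n; rewrite GF.
  apply: ge0_nondecreasing_set_cvg_integral.
  - move=> m n mn; apply/subsetPset => t; rewrite /F /= !in_itv /= !andbT;
    apply: le_lt_trans.
    by rewrite lerN2 ler_nat.
  - by move=> n; exact: measurable_itv.
  - by move=> n; exact: measurable_funTS.
  - by move=> n t _; rewrite lee_fin.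
have /fine_cvgP[_ H'] := H.
have : \forall n \near \oo, 1 - y < 1 - G (- n%:R).
  by apply: cvgr_gt H' _ _; rewrite gtrBl.
by case=> n _ /(_ n (leqnn n)) yn; exists (- n%:R); move: yn; rewrite ltrD2l ltrN2.
Qed.

Lemma density_cdf_surj y : 0 < y < 1 -> exists x, G x = y.
Proof.
move=> /andP[/density_cdf_near0[a Ga] /density_cdf_near1[b Gb]].
have ab : a < b.
  by rewrite ltNge -density_cdf_mono -ltNge (lt_trans Ga Gb).
have intab : lebesgue_measure.-integrable `[a, b] (EFin \o p).
  by apply: density_integrable; exact: measurable_itv.
have GE x : a <= x -> parameterized_integral lebesgue_measure a x p = G x - G a.
  move=> ax; rewrite density_cdfB// Rintegral_itv_obnd_cbnd//.
  by apply: density_integrable; exact: measurable_itv.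
have [||c cab Gc] := @IVT R (fun x => parameterized_integral lebesgue_measure a x p) a b
   (y - G a) (ltW ab).
- exact: parameterized_integral_continuous (ltW ab) intab.
- rewrite /= !GE ?lexx ?(ltW ab)// subrr.
  have Gab := lt_trans Ga Gb.
  by rewrite min_l ?max_r ?subr_ge0 ?lerD2r ?(ltW Ga) ?(ltW Gb) ?(ltW Gab).
exists c; move: Gc; rewrite GE; first by move/(congr1 (fun z => z + G a)); rewrite !subrK.
by move: cab; rewrite in_itv /= => /andP[].
Qed.

Lemma inv_cdfK y : 0 < y < 1 -> G (inv_cdf p y) = y.
Proof.
move=> /density_cdf_surj[x Gx]; apply: pinvK.
by rewrite inE /=; exists x.
Qed.

(** Outside the range of the distribution function the inverse takes its default
    value. *)
Lemma inv_cdf_out y : ~~ (0 < y < 1) -> inv_cdf p y = 0.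
Proof.
move=> yN; rewrite /inv_cdf /pinv_ splitV oinv_surj.
case: pselect => //= h; have [x _ xy] := h; case/negP: yN.
by rewrite -xy density_cdf_gt0 density_cdf_lt1.
Qed.

Lemma inv_cdf_lt y a : 0 < y < 1 -> (inv_cdf p y < a) = (y < G a).
Proof.
by move=> y01; rewrite -{2}(inv_cdfK y01) !ltNge density_cdf_mono.
Qed.

Lemma measurable_inv_cdf : measurable_fun setT (inv_cdf p).
Proof.
apply: (measurability _ (RGenInftyO.measurableE R)) => _ [_ [a ->] <-].
rewrite setTI (_ : _ @^-1` _ = (`]0, 1[%classic `&` `]-oo, G a[%classic) `|`
    ((~` `]0, 1[%classic) `&` [set y | 0 < a])).
  apply: measurableU; apply: measurableI.
  - exact: measurable_itv.
  - exact: measurable_itv.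
  - by apply: measurableC; exact: measurable_itv.
  - case: (ltP 0 a) => _; first by rewrite (_ : [set _ | _] = setT)//; apply/seteqP;
    split.
    by rewrite (_ : [set _ | _] = set0)//; apply/seteqP; split.
apply/seteqP; split => y /=; rewrite !in_itv /=.
  have [y01|/negP y01] := boolP (0 < y < 1).
    by rewrite inv_cdf_lt// => ?; left.
  by rewrite inv_cdf_out//; [right|apply/negP].
move=> [[y01]|[/negP y01 a0]]; first by rewrite inv_cdf_lt.
by rewrite inv_cdf_out.
Qed.

(** The set of uniform numbers that are mapped below [a] has length [G a]. *)
Lemma lebesgue_inv_cdf_lt a :
  lebesgue_measure [set y : R | 0 <= y < 1 /\ inv_cdf p y < a] = (G a)%:E.
Proof.
have G1 := density_cdf_lt1 a; have G0 := density_cdf_gt0 a.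
have itvE b : lebesgue_measure [set` Interval (BSide b 0) (BLeft (G a))] = (G a)%:E.
  by rewrite lebesgue_measure_itv /= lte_fin G0 -EFinB subr0.
have mS : measurable [set y : R | 0 <= y < 1 /\ inv_cdf p y < a].
  rewrite (_ : [set _ | _] = `[0, 1[%classic `&` (inv_cdf p @^-1` `]-oo, a[%classic)).
    apply: measurableI; first exact: measurable_itv.
    by rewrite -[X in measurable X]setTI; apply: measurable_inv_cdf => //;
      exact: measurable_itv.
  by apply/seteqP; split=> y /=; rewrite !in_itv.
apply/eqP; rewrite eq_le -{1}(itvE true) -{1}(itvE false); apply/andP; split.
  apply: le_measure; rewrite ?inE//; try exact: measurable_itv.
  move=> y /= [/andP[y0 y1]]; rewrite in_itv /= y0 /=.
  move: y0; rewrite le_eqVlt => /predU1P[<- //|y0].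
  by rewrite inv_cdf_lt// y0.
apply: le_measure; rewrite ?inE//; try exact: measurable_itv.
move=> y /=; rewrite in_itv /= => /andP[y0 yG].
have y1 := lt_trans yG G1.
by split; [rewrite ltW|rewrite inv_cdf_lt// y0].
Qed.

End cdf_of_positive_density.

(** * The proposal law and inversion *)

Section proposal.
Context (R : realType) (d : nat) (q : 'I_d -> R -> R).
Hypothesis hq : forall j, is_positive_density (q j).

Let mq j : measurable_fun setT (q j). Proof. by case: (hq j). Qed.
Let q_ge0 j t : 0 <= q j t. Proof. by case: (hq j) => _ /(_ t)/ltW. Qed.

Lemma measurable_prod_density : measurable_fun setT (prod_density q).
Proof. exact: measurable_prod_coord. Qed.

Lemma prod_density_gt0 x : 0 < prod_density q x.
Proof. by apply: prodr_gt0 => j _; case: (hq j). Qed.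

Lemma prod_density_ge0 x : 0 <= prod_density q x.
Proof. exact/ltW/prod_density_gt0. Qed.

(** The law with density [q]. *)
Definition proposal : {measure set 'rV[R]_d -> \bar R} :=
  density_measure (lebesgue_row R d) measurable_prod_density prod_density_ge0.

Lemma ge0_integral_proposal (g : 'rV[R]_d -> \bar R) :
  measurable_fun setT g -> (forall x, 0 <= g x)%E ->
  (\int[proposal]_x g x = \int[lebesgue_row R d]_x (g x * (prod_density q x)%:E))%E.
Proof.
move=> mg g0; apply: ge0_integral_density => //.
- exact: measurable_prod_density.
- exact: prod_density_ge0.
Qed.

Lemma proposal_setT : proposal setT = 1%E.
Proof.
rewrite /= /density_measure integral_row_prod//.
by rewrite big1// => j _; case: (hq j).
Qed.

Lemma proposal_orthant a :
  proposal (orthant a) = (\prod_j density_cdf (q j) (a ord0 j))%:E.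
Proof.
rewrite /= /density_measure integral_mkcond.
rewrite (eq_integral (fun x : 'rV[R]_d =>
   (\prod_j (q j (x ord0 j) * \1_(`]-oo, a ord0 j[%classic) (x ord0 j)))%:E)); last first.
  move=> x _; rewrite epatch_indic /= -EFinM; congr (_%:E).
  rewrite big_split /=; congr (_ * _); rewrite indicE.
  have [xa|xa] := boolP (x \in orthant a).
    rewrite big1// => j _; rewrite indicE mem_set//= in_itv /=.
    by move: xa; rewrite inE; apply.
  have /existsNP[j xj] : ~ forall j, x ord0 j < a ord0 j.
    by move=> h; move/negP: xa; apply; rewrite inE.
  rewrite (bigD1 j)//= indicE memNset ?mul0r//= in_itv /=.
rewrite (@integral_row_prod _ _ (fun j t => q j t * \1_(`]-oo, a ord0 j[%classic) t));
  last 2 first.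
- move=> j; apply: measurable_funM => //.
- by move=> j t; rewrite mulr_ge0// indicE.
rewrite -prodEFin; apply: eq_bigr => j _.
rewrite -(density_cdf_oE (hq j)) [RHS]integral_mkcond; apply: eq_integral => t _.
by rewrite epatch_indic /= -EFinM.
Qed.

Lemma measurable_inv_cdf_row : measurable_fun setT (inv_cdf_row q).
Proof.
apply: measurable_fun_row => i.
rewrite (_ : (fun _ => _) = inv_cdf (q i) \o (fun x : 'rV[R]_d => x ord0 i)).
  by apply: measurableT_comp; [exact: measurable_inv_cdf|exact: measurable_coord].
by apply/funext => x; rewrite /= mxE.
Qed.

Section law.
Context d1 (T : measurableType d1) (P : probability T R) (Y : {RV P >-> 'rV[R]_d}).
Hypothesis hY : has_density Y \1_(@unit_cube R d).

Lemma measurable_inv_RV : measurable_fun setT (inv_cdf_row q \o Y).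
Proof. by apply: measurableT_comp => //; exact: measurable_inv_cdf_row. Qed.

Lemma uniform_box (B : 'I_d -> set R) : (forall i, measurable (B i)) ->
  (forall i, B i `<=` [set t | 0 <= t < 1]) ->
  P [set w | forall i, B i (Y w ord0 i)] = (\prod_i lebesgue_measure (B i))%E.
Proof.
move=> mB B01; pose A := [set x : 'rV[R]_d | forall i, B i (x ord0 i)].
have mA : measurable A.
  rewrite (_ : A = \bigcap_(i in [set: 'I_d])
      ((fun x : 'rV[R]_d => x ord0 i) @^-1` B i)).
    apply: fin_bigcap_measurable => [|i _]; first exact: finite_finset.
    by rewrite -[X in measurable X]setTI; exact: measurable_coord.
  by apply/seteqP; split=> x /= h i => [_|]; exact: h.
rewrite -lebesgue_row_box// -[LHS]/(distribution P Y A) hY//.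
rewrite (eq_integral (cst 1%E)) ?integral_cst ?mul1e// => x.
rewrite inE => Ax; rewrite indicE mem_set//= => i.
by have /B01 := Ax i.
Qed.

(** Inversion turns a uniform point of the cube into a sample of [q]. *)
Lemma inv_law A : measurable A -> P ((inv_cdf_row q \o Y) @^-1` A) = proposal A.
Proof.
have E a : P ((inv_cdf_row q \o Y) @^-1` orthant a) = proposal (orthant a).
  rewrite proposal_orthant.
  pose B (i : 'I_d) := [set y : R | 0 <= y < 1 /\ inv_cdf (q i) y < a ord0 i].
  have mB i : measurable (B i).
    rewrite (_ : B i = `[0, 1[%classic `&` (inv_cdf (q i) @^-1` `]-oo, a ord0
      i[%classic)).
      apply: measurableI; first exact: measurable_itv.
      rewrite -[X in measurable X]setTI; apply: (measurable_inv_cdf (hq i)) => //.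
    by apply/seteqP; split=> y /=; rewrite !in_itv.
  rewrite -prodEFin (eq_bigr (fun i => lebesgue_measure (B i))); last first.
    by move=> i _; rewrite lebesgue_inv_cdf_lt.
  rewrite -lebesgue_row_box// -[LHS]/(distribution P Y (inv_cdf_row q @^-1` orthant a)).
  have mO : measurable (inv_cdf_row q @^-1` orthant a).
    rewrite -[X in measurable X]setTI; apply: measurable_inv_cdf_row => //.
    exact: measurable_orthant.
  rewrite hY// integral_indic//; last first.
    rewrite (_ : @unit_cube R d = \bigcap_(i in [set: 'I_d])
        ((fun x : 'rV[R]_d => x ord0 i) @^-1` `[0, 1[%classic)).
      apply: fin_bigcap_measurable => [|i _]; first exact: finite_finset.
      by rewrite -[X in measurable X]setTI; apply: measurable_coord => //;
        exact: measurable_itv.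
    apply/seteqP; split=> x /= h i; first by rewrite /= in_itv /= h.
    by have := h i Logic.I; rewrite /= in_itv.
  congr (lebesgue_row R d _); apply/seteqP; split => x /=.
    by move=> [h1 h2] i; split; [exact: h1|have := h2 i; rewrite mxE].
  by move=> h; split => i; [case: (h i)|rewrite mxE; case: (h i)].
pose Z : {RV P >-> 'rV[R]_d} := mfun_Sub (mem_set measurable_inv_RV).
move=> mA; rewrite -[LHS]/(distribution P Z A).
apply: (@orthant_measure_unique R d (distribution P Z) proposal) => // a.
by rewrite [X in (X < _)%E]E proposal_orthant ltry.
Qed.

Lemma ge0_integral_inv (g : 'rV[R]_d -> \bar R) :
  measurable_fun setT g -> (forall x, 0 <= g x)%E ->
  (\int[P]_w g (inv_cdf_row q (Y w)) = \int[proposal]_x g x)%E.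
Proof.
move=> mg g0.
pose Z : {RV P >-> 'rV[R]_d} := mfun_Sub (mem_set measurable_inv_RV).
transitivity (\int[distribution P Z]_x g x)%E.
  by rewrite ge0_integral_distribution.
by apply: eq_measure_integral => A mA _; exact: inv_law.
Qed.

(** Almost surely no coordinate of a uniform point is 0, where the inverse
    distribution function has no meaning. *)
Lemma uniform_gt0_ae : (forall w, unit_cube (Y w)) ->
  {ae P, forall w, forall i, 0 < Y w ord0 i < 1}.
Proof.
move=> cY; have Y0 i : {ae P, forall w, Y w ord0 i != 0}.
  pose B (k : 'I_d) : set R := if k == i then `[0, 0]%classic else `[0, 1[%classic.
  exists [set w | forall k, B k (Y w ord0 k)]; split.
  - rewrite (_ : [set w | _] = \bigcap_(k in [set: 'I_d])
        ((fun w => Y w ord0 k) @^-1` B k)).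
      apply: fin_bigcap_measurable => [|k _]; first exact: finite_finset.
      rewrite -[X in measurable X]setTI.
      have : measurable_fun setT (fun w => Y w ord0 k).
        by apply: (measurableT_comp (measurable_coord k)).
      by apply => //; rewrite /B; case: ifP => _; exact: measurable_itv.
    by apply/seteqP; split=> x /= h k => [_|]; exact: h.
  - rewrite uniform_box => [|k|k].
    + rewrite (bigD1 i)//= /B eqxx lebesgue_measure_itv /= lte_fin ltxx.
      by rewrite mul0e.
    + by rewrite /B; case: ifP => _; exact: measurable_itv.
    + rewrite /B; case: ifP => _ t /=; rewrite in_itv //=.
      by move=> /andP[h1 h2]; rewrite h1 (le_lt_trans h2).
  - move=> w /= /negP; rewrite negbK => /eqP Yi k; rewrite /B.
    case: eqP => [->|_]; rewrite /= in_itv /= ?Yi ?lexx//.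
    exact: cY.
have H : {ae P, forall w, forall i, Y w ord0 i != 0} by exact: filter_forall.
apply: filterS H => w h i.
by rewrite lt_neqAle eq_sym h; exact: cY.
Qed.

End law.
End proposal.

(** * Grid approximation and local discrepancy *)

Section grid_limit.
Context (R : realType) (d : nat) (M S : R) (g : 'rV[R]_d -> R).
Hypotheses (M_gt0 : 0 < M) (g_cont : continuous g).
Hypothesis g_supp : forall (x : 'rV[R]_d) i, M <= `|x ord0 i| -> g x = 0.

Lemma grid_corner_cvg (t : R) : - M <= t < M ->
  grid_corner M n.+1 t @[n --> \oo] --> t.
Proof.
move=> tM; apply/cvgrPdist_lt => e e0.
have e1 : 0 < e / (2 * M) by rewrite divr_gt0// mulr_gt0.
near=> n; have /andP[h1 h2] := grid_corner_bracket M_gt0 (ltn0Sn n) tM.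
rewrite distrC gtr0_norm ?subr_gt0// ltrBlDl; apply: le_lt_trans h2 _.
rewrite ltrD2l /grid_step.
rewrite mulrC -ltr_pdivlMr ?mulr_gt0//.
by near: n; exact: (near_infty_natSinv_lt (PosNum e1)).
Unshelve. all: end_near. Qed.

Lemma grid_row_cvg (x : 'rV[R]_d) : g (grid_row M n.+1 x) @[n --> \oo] --> g x.
Proof.
have [xM|/existsNP[i xi]] := pselect (forall i, - M <= x ord0 i < M).
  apply: continuous_cvg; first exact: g_cont.
  apply/cvg_ballP => e e0; near=> n; split=> // i j; rewrite ord1 mxE.
  move: j; near: n; apply: filter_forall => j.
  have := grid_corner_cvg (xM j).
  by move/cvg_ballP; apply.
have gx : g x = 0.
  apply: (g_supp (i := i)); rewrite leNgt ltr_norml; apply/negP => /andP[a b].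
  by apply: xi; rewrite (ltW a) b.
rewrite gx [X in X @ _ --> _](_ : _ = cst 0); first exact: cvg_cst.
apply/funext => n /=; apply: (g_supp (i := i)); rewrite mxE.
case: (leP M (x ord0 i)) => h1.
  by rewrite grid_corner_ge// gtr0_norm.
have h2 : x ord0 i < - M by rewrite ltNge; apply/negP => h2; apply: xi; rewrite h2.
rewrite /grid_corner (_ : grid_index _ _ _ _ = 0)%N.
  by rewrite grid_point0 normrN gtr0_norm.
rewrite /grid_index big1// => k _.
rewrite leNgt (lt_le_trans h2)// -(grid_point0 M n.+1).
exact: grid_point_homo.
Unshelve. all: end_near. Qed.

(** On each grid a compactly supported function is a combination of indicators of
    orthants, and the sum of the norms of the coefficients has a bound that does
    not depend on the grid. *)
Lemma grid_approx :
  iter_derivable (enum 'I_d) g ->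
  (forall x, `|iter_partial (enum 'I_d) g x| <= S) ->
  exists L : nat -> seq (R * 'rV[R]_d),
    (forall n x, g (grid_row M n.+1 x) = \sum_(p <- L n) p.1 * \1_(orthant p.2) x) /\
    (forall n, \sum_(p <- L n) `|p.1| <= (2 * M) ^+ d * S).
Proof.
move=> dg gS.
have /choice[L HL] : forall n, exists L : seq (R * 'rV[R]_d),
    (forall x, g (grid_row M n.+1 x) = \sum_(p <- L) p.1 * \1_(orthant p.2) x) /\
    \sum_(p <- L) `|p.1| <= (2 * M) ^+ d * S.
  move=> n; have [||L [L1 L2]] := @grid_expansion R M n.+1 M_gt0 (ltn0Sn n) d
      (enum 'I_d) g S (enum_uniq _) _ dg gS.
  - by move=> x x' h; congr g; apply/rowP => i; apply: h; rewrite mem_enum.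
  - by move=> x i _ xi; apply: (g_supp (i := i)); rewrite xi gtr0_norm.
  exists L; split; last by move: L2; rewrite size_enum_ord.
  move=> x; rewrite L1; apply: eq_bigr => p _; congr (_ * _).
  rewrite big_enum /= indicE.
  have [xa|xa] := boolP (x \in orthant p.2).
    by rewrite big1// => j _; move: xa; rewrite inE => /(_ j) ->.
  have /existsNP[j xj] : ~ forall j, x ord0 j < p.2 ord0 j.
    by move=> h; move/negP: xa; apply; rewrite inE.
  by rewrite (bigD1 j)//= (negPf (introN idP xj)) mul0r.
by exists L; split => [n x|n]; case: (HL n).
Qed.

End grid_limit.

Section discrepancy.
Context (R : realType) (d : nat) (q : 'I_d -> R -> R).
Hypothesis hq : forall j, is_positive_density (q j).
Variables (n : nat) (ys : 'I_n -> 'rV[R]_d).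
Hypothesis ys01 : forall j i, 0 < ys j ord0 i < 1.

(** The local discrepancy of the transformed points at an orthant is the local
    discrepancy of the original points at the corner of its image. *)
Lemma orthant_discrepancy (a : 'rV[R]_d) :
  `|(\sum_j \1_(orthant a) (inv_cdf_row q (ys j))) / n%:R
     - \prod_i density_cdf (q i) (a ord0 i)| <= star_discrepancy ys.
Proof.
pose c : 'rV[R]_d := \row_i density_cdf (q i) (a ord0 i).
have c01 i : 0 <= c ord0 i <= 1.
  by rewrite mxE density_cdf_ge0// density_cdf_le1.
apply: ub_le_sup; last first.
  exists c => //=; congr (`|_ / _ - _|); last first.
    by apply: eq_bigr => i _; rewrite mxE.
  rewrite -sum1_card natr_sum big_mkcond /=; apply: eq_bigr => j _.
  rewrite indicE.
  have -> : (inv_cdf_row q (ys j) \in orthant a) = [forall i, 0 <= ys j ord0 i < c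
    ord0 i].
    apply/idP/forallP.
      rewrite inE => h i; have := h i; rewrite !mxE inv_cdf_lt// => ->.
      by case/andP: (ys01 j i) => /ltW ->.
    move=> h; rewrite inE => i; have := h i; rewrite !mxE => /andP[_ ?].
    by rewrite inv_cdf_lt.
  by rewrite inE; case: ifP.
exists 2 => _ [b b01 <-].
apply: le_trans (ler_normB _ _) _; rewrite (_ : 2 = 1 + 1) //; apply: lerD.
  rewrite normrM !ger0_norm ?invr_ge0//.
  case: (posnP n) => [n0|n0]; first by rewrite [X in _ / X%:R]n0 invr0 mulr0.
  rewrite ler_pdivrMr ?ltr0n// mul1r ler_nat.
  by apply: leq_trans (max_card _) _; rewrite card_ord.
rewrite ger0_norm; last by apply: prodr_ge0 => i _; case/andP: (b01 i).
by apply: prodr_ile1 => i _; exact: b01.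
Qed.

End discrepancy.

(** * The Koksma-Hlawka inequality *)

Section koksma_hlawka.
Context (R : realType) (d : nat) (q : 'I_d -> R -> R).
Hypothesis hq : forall j, is_positive_density (q j).

Lemma proposal_lty (A : set 'rV[R]_d) : measurable A -> (proposal hq A < +oo)%E.
Proof.
move=> mA; apply: (@le_lt_trans _ _ (proposal hq setT)).
  by apply: le_measure; rewrite ?inE.
by rewrite proposal_setT ltry.
Qed.

Lemma bounded_proposal_integrable (g : 'rV[R]_d -> R) (K : R) :
  measurable_fun setT g -> (forall x, `|g x| <= K) ->
  (proposal hq).-integrable setT (EFin \o g).
Proof.
move=> mg gK; apply: measurable_bounded_integrable => //.
  exact: proposal_lty.
exists K; split; first exact: num_real.
by move=> r Kr x _ /=; apply: le_trans (gK x) _; exact: ltW.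
Qed.

Lemma measurable_steps (L : seq (R * 'rV[R]_d)) :
  measurable_fun setT (fun x => \sum_(p <- L) p.1 * \1_(orthant p.2) x).
Proof.
apply: measurable_sum => p; apply: measurable_funM => //.
by apply: measurable_indic; exact: measurable_orthant.
Qed.

Lemma integral_steps (L : seq (R * 'rV[R]_d)) :
  (\int[proposal hq]_x (\sum_(p <- L) p.1 * \1_(orthant p.2) x)%:E =
  (\sum_(p <- L) p.1 * \prod_i density_cdf (q i) (p.2 ord0 i))%:E)%E.
Proof.
have int1 (p : R * 'rV[R]_d) :
    (proposal hq).-integrable setT (EFin \o (fun x => p.1 * \1_(orthant p.2) x)).
  apply: (@bounded_proposal_integrable _ `|p.1|).
    apply: measurable_funM => //.
    by apply: measurable_indic; exact: measurable_orthant.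
  by move=> x; rewrite normrM ler_piMr// indicE; case: (_ \in _); rewrite ?normr1 ?normr0.
have intL (L' : seq (R * 'rV[R]_d)) : (proposal hq).-integrable setT
    (EFin \o (fun x => \sum_(p <- L') p.1 * \1_(orthant p.2) x)).
  apply: (@bounded_proposal_integrable _ (\sum_(p <- L') `|p.1|)).
    exact: measurable_steps.
  move=> x; apply: le_trans (ler_norm_sum _ _ _) _; apply: ler_sum => p _.
  by rewrite normrM ler_piMr// indicE; case: (_ \in _); rewrite ?normr1 ?normr0.
elim: L => [|p L IH].
  by rewrite big_nil; apply: integral0_eq => x _; rewrite big_nil.
rewrite big_cons EFinD -IH.
under eq_integral do rewrite big_cons EFinD.
rewrite integralD_EFin//; congr (_ + _)%E.
rewrite (eq_integral (fun x => p.1%:E * (\1_(orthant p.2) x)%:E)%E); last first.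
  by move=> x _; rewrite /= EFinM.
rewrite integralZl//; last first.
  apply: (@bounded_proposal_integrable (\1_(orthant p.2)) 1).
    by apply: measurable_indic; exact: measurable_orthant.
  by move=> x; rewrite indicE; case: (_ \in _); rewrite ?normr1 ?normr0.
rewrite integral_indic ?setIT//; last exact: measurable_orthant.
by rewrite proposal_orthant -EFinM.
Qed.

Variables (M S K : R) (g : 'rV[R]_d -> R).
Hypotheses (M_gt0 : 0 < M) (g_cont : continuous g).
Hypothesis g_supp : forall (x : 'rV[R]_d) i, M <= `|x ord0 i| -> g x = 0.
Hypothesis dg : iter_derivable (enum 'I_d) g.
Hypothesis gS : forall x, `|iter_partial (enum 'I_d) g x| <= S.
Hypothesis gK : forall x, `|g x| <= K.

Lemma measurable_compact_support : measurable_fun setT g.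
Proof.
have [L [L1 _]] := grid_approx M_gt0 g_supp dg gS.
apply: (@measurable_fun_cvg _ _ R _ (fun n x => g (grid_row M n.+1 x))).
  move=> n; rewrite (_ : (fun x => _) = fun x => \sum_(p <- L n) p.1 * \1_(orthant
    p.2) x).
    exact: measurable_steps.
  by apply/funext => x; rewrite L1.
by move=> x _; exact: grid_row_cvg.
Qed.

(** The Koksma--Hlawka inequality for a function with compact support, under
    inversion of the marginal distribution functions. *)
Lemma koksma_hlawka n (ys : 'I_n -> 'rV[R]_d) :
  (forall j i, 0 < ys j ord0 i < 1) ->
  `|(\sum_j g (inv_cdf_row q (ys j))) / n%:R - fine (\int[proposal hq]_x (g x)%:E)%E|
  <= star_discrepancy ys * ((2 * M) ^+ d * S).
Proof.
move=> ys01; have [L [L1 L2]] := grid_approx M_gt0 g_supp dg gS.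
have mg := measurable_compact_support.
pose gN N x := g (grid_row M N.+1 x).
have mgN N : measurable_fun setT (gN N).
  rewrite (_ : gN N = fun x => \sum_(p <- L N) p.1 * \1_(orthant p.2) x).
    exact: measurable_steps.
  by apply/funext => x; rewrite -L1.
pose I N := fine (\int[proposal hq]_x (gN N x)%:E)%E.
have IE N : I N = \sum_(p <- L N) p.1 * \prod_i density_cdf (q i) (p.2 ord0 i).
  rewrite /I -[RHS]/(fine _%:E) -integral_steps; congr fine.
  by apply: eq_integral => x _; rewrite -L1.
have Icvg : I N @[N --> \oo] --> fine (\int[proposal hq]_x (g x)%:E)%E.
  apply: fine_cvg; rewrite fineK; last first.
    by apply: integrable_fin_num => //; exact: bounded_proposal_integrable mg gK.
  have [] := @dominated_convergence _ _ _ (proposal hq) setT measurableT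
    (fun N x => (gN N x)%:E) (EFin \o g) (cst K%:E) => //.
  - by move=> N; exact/measurable_EFinP.
  - exact/measurable_EFinP.
  - apply: aeW => x _; apply: cvg_EFin; first by apply: nearW.
    exact: grid_row_cvg.
  - apply: (@bounded_proposal_integrable (cst K) `|K|) => //.
  - by apply: aeW => x N _; rewrite lee_fin; exact: gK.
have Scvg : (\sum_j gN N (inv_cdf_row q (ys j))) / n%:R @[N --> \oo] -->
    (\sum_j g (inv_cdf_row q (ys j))) / n%:R.
  apply: cvgMl; apply: cvg_big => [|j _]; first exact: add_continuous.
  exact: grid_row_cvg.
have H : `|(\sum_j gN N (inv_cdf_row q (ys j))) / n%:R - I N| @[N --> \oo] -->
  `|(\sum_j g (inv_cdf_row q (ys j))) / n%:R - fine (\int[proposal hq]_x (g x)%:E)%E|.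
  by apply: cvg_norm; exact: cvgB.
apply: (cvgr_to_le H); apply: nearW => N.
rewrite IE; under eq_bigr do rewrite /gN L1.
rewrite exchange_big /= big_distrl /= -sumrB.
apply: le_trans (ler_norm_sum _ _ _) _.
apply: (@le_trans _ _ (\sum_(p <- L N) `|p.1| * star_discrepancy ys)).
  apply: ler_sum => p _; rewrite -big_distrr /= -mulrA -mulrBr normrM ler_wpM2l//.
  exact: orthant_discrepancy.
rewrite -big_distrl /= mulrC ler_wpM2l//.
apply: le_trans (orthant_discrepancy hq ys01 0).
exact: normr_ge0.
Qed.

End koksma_hlawka.

(** * Truncation of the integrand *)

Section euclidean_norm.
Context (R : realType) (d : nat).
Implicit Types (x : 'rV[R]_d) (r : R).

Lemma enorm_ge0 x : 0 <= enorm x.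
Proof. exact: sqrtr_ge0. Qed.

Lemma enorm_sq x : enorm x ^+ 2 = \sum_i x ord0 i ^+ 2.
Proof. by rewrite sqr_sqrtr// sumr_ge0// => i _; exact: sqr_ge0. Qed.

Lemma norm_coord_le_enorm x i : `|x ord0 i| <= enorm x.
Proof.
rewrite -sqrtr_sqr ler_wsqrtr// (bigD1 i)//= lerDl.
by rewrite sumr_ge0// => j _; exact: sqr_ge0.
Qed.

Lemma enorm_le_box x r : 0 <= r -> (forall i, `|x ord0 i| <= r) ->
  enorm x <= Num.sqrt d%:R * r.
Proof.
move=> r0 xr; rewrite -{1}(ger0_norm r0) -sqrtr_sqr -sqrtrM ?ler0n//.
rewrite ler_wsqrtr// -[d in d%:R]card_ord mulr_natl -sumr_const; apply: ler_sum => i _.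
by rewrite -(ger0_norm (sqr_ge0 (x ord0 i))) normrX lerXn2r// nnegrE.
Qed.

Lemma measurable_enorm : measurable_fun setT (@enorm R d).
Proof.
apply: (@measurableT_comp _ _ _ _ _ _ (@Num.sqrt R)) => //.
  exact: continuous_measurable_fun (@sqrt_continuous R).
apply: measurable_sum => i; apply: measurable_funX.
exact: measurable_coord.
Qed.

End euclidean_norm.

Section truncation.
Context (R : realType) (d : nat) (h : 'rV[R]_d -> R) (A B C : R).
Hypothesis hS : class_S h.
Hypotheses (A_gt0 : 0 < A) (B_gt0 : 0 < B) (C_gt0 : 0 < C).
Hypothesis h_growth : forall (u : {set 'I_d}) (x : 'rV[R]_d),
  `|mixed_partial u h x| <= C * expR (A * enorm x ^+ 2 + B * enorm x).
Implicit Types (x : 'rV[R]_d) (r s : R).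

Let mixed_partial0 : mixed_partial (@finset.set0 _) h = h.
Proof. by rewrite /mixed_partial enum_set0. Qed.

Lemma class_S_continuous : continuous h.
Proof. by have [_] := hS (@finset.set0 _); rewrite mixed_partial0. Qed.

Lemma std_normalE x : std_normal_density x =
  normal_peak 1 ^+ d * expR (- (enorm x ^+ 2) / 2).
Proof.
rewrite /std_normal_density /prod_density.
under eq_bigr do rewrite normal_pdf01E.
rewrite big_split /= prodr_const card_ord -expR_sum; congr (_ * expR _).
by rewrite enorm_sq -sumrN mulr_suml; apply: eq_bigr => i _; rewrite mulNr.
Qed.

(** The integrand [phi * h]. *)
Definition gauss_mul x : R := std_normal_density x * h x.

(** The truncation of [phi * h] to the box [[-r, r] ^ d]. *)
Definition truncated r x : R := h x * \prod_i cut_gauss r (x ord0 i).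

(** Pointwise bound of [phi * h] that follows from the growth of [h]. *)
Definition tail_bound x : R :=
  C * normal_peak 1 ^+ d * expR ((A - 2^-1) * enorm x ^+ 2 + B * enorm x).

Lemma growth_std_normal (w : R) x : `|w| <= C * expR (A * enorm x ^+ 2 + B * enorm x) ->
  `|w| * std_normal_density x <= tail_bound x.
Proof.
move=> hw; have p0 : 0 <= std_normal_density x.
  by rewrite std_normalE mulr_ge0 ?expR_ge0// exprn_ge0// normal_peak_ge0.
apply: le_trans (ler_wpM2r p0 hw) _; rewrite std_normalE /tail_bound.
rewrite [leLHS](_ : _ = C * normal_peak 1 ^+ d *
   (expR (A * enorm x ^+ 2 + B * enorm x) * expR (- (enorm x ^+ 2) / 2))); last by ring.
rewrite -expRD (_ : _ + _ / 2 = (A - 2^-1) * enorm x ^+ 2 + B * enorm x)//; lra.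
Qed.

Lemma norm_gauss_mul_le x : `|gauss_mul x| <= tail_bound x.
Proof.
have p0 : 0 <= std_normal_density x.
  by rewrite std_normalE mulr_ge0 ?expR_ge0// exprn_ge0// normal_peak_ge0.
rewrite /gauss_mul normrM mulrC (ger0_norm p0); apply: growth_std_normal.
by have := h_growth (@finset.set0 _) x; rewrite mixed_partial0.
Qed.

Lemma truncated_supp r x i : r <= `|x ord0 i| -> truncated r x = 0.
Proof.
by move=> hr; rewrite /truncated (bigD1 i)//= /cut_gauss (cutoff_out hr).1 !mul0r mulr0.
Qed.

Lemma truncated_continuous r : continuous (truncated r).
Proof.
move=> x; apply: (@cvgM _ _ (nbhs x) (nbhs_filter x)); first exact: class_S_continuous.
apply: cvg_big => [|i _]; first exact: mul_continuous.
apply: continuous_cvg; last exact: coord_continuous.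
apply: differentiable_continuous; apply/derivable1_diffP.
by case: (is_derive_cut_gauss r (x ord0 i)).
Qed.

Lemma sublist_iter_derivable v : v \in sublists (enum 'I_d) -> iter_derivable v h.
Proof. by move=> /sublist_enum_set ->; case: (hS [set i in v]). Qed.

Lemma truncated_derivable r : iter_derivable (enum 'I_d) (truncated r).
Proof.
by have [] := @iter_partial_leibniz R d h _ _ (is_derive_cut_gauss r) (enum 'I_d)
  (enum_uniq _) sublist_iter_derivable.
Qed.

(** Pointwise bound, inside the box, of the mixed derivative of the truncated
    integrand in all the variables. *)
Definition box_bound x : R := 2 ^+ d * (tail_bound x * \prod_i (4 + `|x ord0 i|)).

Lemma growth_cut_gauss r (S : R) (w : R) x : 0 <= S ->
  (forall x, (forall i, `|x ord0 i| <= r) -> box_bound x <= S) ->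
  `|w| <= C * expR (A * enorm x ^+ 2 + B * enorm x) ->
  2 ^+ d * (`|w| * \prod_i cut_gauss_bound r (x ord0 i)) <= S.
Proof.
move=> S0 HS hw; have [xr|/existsNP[i /negP xi]] := pselect (forall i, `|x ord0 i| <= r).
  apply: le_trans (HS x xr); rewrite ler_wpM2l ?exprn_ge0//.
  rewrite (eq_bigr (fun i => (4 + `|x ord0 i|) * normal_pdf 0 1 (x ord0 i))); last first.
    by move=> i _; rewrite /cut_gauss_bound xr.
  rewrite big_split /= mulrCA mulrC ler_wpM2r//.
    by apply: prodr_ge0 => i _; rewrite addr_ge0.
  exact: growth_std_normal.
by rewrite (bigD1 i)//= /cut_gauss_bound (negPf xi) mul0r !mulr0.
Qed.

Lemma norm_truncated_partial r (S : R) x : 0 <= S ->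
  (forall x, (forall i, `|x ord0 i| <= r) -> box_bound x <= S) ->
  `|iter_partial (enum 'I_d) (truncated r) x| <= S.
Proof.
move=> S0 HS; pose E := C * expR (A * enorm x ^+ 2 + B * enorm x).
have E0 : 0 <= E by rewrite mulr_ge0 ?expR_ge0// ltW.
apply: le_trans (norm_leibniz_le (is_derive_cut_gauss r) (B := E) (enum_uniq _)
  sublist_iter_derivable _ (norm_cut_gauss_le r) (norm_dcut_gauss_le r)) _.
  by move=> v /sublist_enum_set ->; exact: h_growth.
rewrite size_enum_ord -(ger0_norm E0); apply: growth_cut_gauss => //.
by rewrite ger0_norm.
Qed.

Lemma norm_truncated_le r (S : R) x : 0 <= S ->
  (forall x, (forall i, `|x ord0 i| <= r) -> box_bound x <= S) ->
  `|truncated r x| <= S.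
Proof.
move=> S0 HS; have hw := h_growth (@finset.set0 _) x; rewrite mixed_partial0 in hw.
apply: le_trans (growth_cut_gauss S0 HS hw).
rewrite normrM normr_prod.
have P0 : 0 <= \prod_i cut_gauss_bound r (x ord0 i).
  apply: prodr_ge0 => i _; exact: le_trans (norm_cut_gauss_le r _).
apply: (@le_trans _ _ (`|h x| * \prod_i cut_gauss_bound r (x ord0 i))).
  apply: ler_wpM2l => //; apply: ler_prod => i _; rewrite normr_ge0.
  exact: norm_cut_gauss_le.
by rewrite ler_peMl ?mulr_ge0// exprn_ege1// ler1n.
Qed.

(** The truncation only changes [phi * h] where the norm is at least [r - 1]. *)
Lemma norm_truncation_error r x :
  `|gauss_mul x - truncated r x| <=
  tail_bound x * \1_[set z : 'rV[R]_d | r - 1 <= enorm z] x.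
Proof.
have cE : truncated r x = gauss_mul x * \prod_i cutoff r (x ord0 i).
  by rewrite /truncated /gauss_mul /std_normal_density /prod_density big_split /=; ring.
rewrite cE -{1}[gauss_mul x]mulr1 -mulrBr normrM; apply: ler_pM => //.
  exact: norm_gauss_mul_le.
rewrite indicE; case: (boolP (x \in _)) => xr.
  have p1 : 0 <= \prod_i cutoff r (x ord0 i) <= 1.
    apply/andP; split; first by apply: prodr_ge0 => i _;
      case/andP: (cutoff_itv r (x ord0 i)).
    by apply: prodr_ile1 => i _; exact: cutoff_itv.
  by rewrite ger0_norm ?subr_ge0 ?lerBlDr ?lerDl; case/andP: p1.
rewrite big1 ?subrr ?normr0// => i _; apply: cutoff_in.
apply: le_trans (norm_coord_le_enorm x i) _.
by rewrite leNgt; apply: contra xr => h1; rewrite inE /= ltW.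
Qed.

Lemma tail_bound_ge0 x : 0 <= tail_bound x.
Proof. by apply: le_trans (norm_gauss_mul_le x). Qed.

Lemma exists_box_bound r : 0 <= r -> exists2 S, 0 <= S &
  forall x, (forall i, `|x ord0 i| <= r) -> box_bound x <= S.
Proof.
move=> r0; pose e := Num.sqrt d%:R * r.
have e0 : 0 <= e by rewrite mulr_ge0// sqrtr_ge0.
pose c := C * normal_peak 1 ^+ d.
have c0 : 0 <= c by rewrite mulr_ge0 ?(ltW C_gt0)// exprn_ge0// normal_peak_ge0.
exists (2 ^+ d * (c * expR (A * e ^+ 2 + B * e) * (4 + r) ^+ d)).
  apply: mulr_ge0; first by rewrite exprn_ge0.
  apply: mulr_ge0; first by rewrite mulr_ge0// expR_ge0.
  by rewrite exprn_ge0// addr_ge0.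
move=> x xr; rewrite /box_bound /tail_bound -/c ler_wpM2l ?exprn_ge0//.
have xe := enorm_le_box r0 xr; rewrite -/e in xe.
have x0 := enorm_ge0 x.
apply: ler_pM.
- by rewrite mulr_ge0// expR_ge0.
- by apply: prodr_ge0 => i _; rewrite addr_ge0.
- apply: ler_wpM2l => //; rewrite ler_expR; apply: lerD; last by rewrite ler_pM2l.
  apply: (@le_trans _ _ (A * enorm x ^+ 2)).
    by rewrite ler_wpM2r ?sqr_ge0// gerBl invr_ge0.
  by rewrite ler_pM2l// lerXn2r// nnegrE.
- rewrite -[d in _ ^+ d]card_ord -prodr_const; apply: ler_prod => i _.
  by rewrite addr_ge0//= lerD2l.
Qed.

End truncation.

(** * Measurability and the target expectation *)

Section expectation_under_density.
Context (R : realType) (d : nat) (p : 'rV[R]_d -> R).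
Context d2 (T' : measurableType d2) (P' : probability T' R).
Variable X : {RV P' >-> 'rV[R]_d}.
Hypotheses (mp : measurable_fun setT p) (p0 : forall x, 0 <= p x).
Hypothesis hX : has_density X p.

Lemma ge0_expectation_density (g : 'rV[R]_d -> \bar R) :
  measurable_fun setT g -> (forall x, 0 <= g x)%E ->
  (\int[P']_w g (X w) = \int[lebesgue_row R d]_x (g x * (p x)%:E))%E.
Proof.
move=> mg g0; rewrite -(ge0_integral_density mp p0 (nu := distribution P' X))//.
by rewrite ge0_integral_distribution.
Qed.

End expectation_under_density.

Section importance_sampling.
Context (R : realType) (d : nat) (q : 'I_d -> R -> R).
Hypothesis hq : forall j, is_positive_density (q j).
Variables (f : 'rV[R]_d -> R) (A B C : R).
Let h := fun x => f x / prod_density q x.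
Hypothesis hf : class_S h.
Hypotheses (A_gt0 : 0 < A) (B_gt0 : 0 < B) (C_gt0 : 0 < C).
Hypothesis h_growth : forall (u : {set 'I_d}) (x : 'rV[R]_d),
  `|mixed_partial u h x| <= C * expR (A * enorm x ^+ 2 + B * enorm x).

Let F := gauss_mul h.
Let Q := proposal hq.
Let tail r (x : 'rV[R]_d) := tail_bound A B C x * \1_[set z : 'rV[R]_d | r - 1 <=
  enorm z] x.

Lemma f_ISE x : f_IS q f x = F x.
Proof. by rewrite /f_IS /F /gauss_mul /h mulrA. Qed.

Lemma measurable_truncated r : 0 < r -> measurable_fun setT (truncated h r).
Proof.
move=> r0; have [S S0 HS] := exists_box_bound d A_gt0 B_gt0 C_gt0 (ltW r0).
apply: (@measurable_compact_support _ _ r S) => //.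
- exact: truncated_continuous.
- by move=> x i; exact: truncated_supp.
- exact: truncated_derivable.
- by move=> x; exact: (norm_truncated_partial hf C_gt0 h_growth).
Qed.

Lemma measurable_gauss_mul : measurable_fun setT F.
Proof.
apply: (@measurable_fun_cvg _ _ R _ (fun n => truncated h n.+1%:R)).
  by move=> n; exact: measurable_truncated.
move=> x _; apply: cvg_near_cst; exists (Num.truncn (enorm x)).+1 => // n /= xn.
apply/eqP; rewrite -subr_eq0 -normr_le0 distrC.
apply: le_trans (norm_truncation_error h_growth _ _) _.
rewrite indicE memNset ?mulr0//=; apply/negP; rewrite -ltNge.
rewrite -natr1 addrK; apply: lt_le_trans (truncnS_gt _) _.
by rewrite ler_nat.
Qed.

Lemma measurable_tail r : measurable_fun setT (tail r).
Proof.
have me := @measurable_enorm R d.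
apply: measurable_funM.
  apply: measurable_funM => //; apply: measurableT_comp => //.
  apply: measurable_funD; apply: measurable_funM => //.
  exact: measurable_funX.
apply: measurable_indic; rewrite -[X in measurable X]setTI.
rewrite (_ : [set z | _] = @enorm R d @^-1` `[r - 1, +oo[%classic).
  by apply: me => //; exact: measurable_itv.
by apply/seteqP; split=> z /=; rewrite in_itv /= andbT.
Qed.

Section target.
Context d2 (T' : measurableType d2) (P' : probability T' R).
Variable X : {RV P' >-> 'rV[R]_d}.
Hypothesis hX : has_density X (@std_normal_density R d).

Let std0 x : 0 < @std_normal_density R d x.
Proof. by apply: prodr_gt0 => i _; exact: normal_pdf01_gt0. Qed.

Let mstd : measurable_fun setT (@std_normal_density R d).
Proof. by apply: measurable_prod_coord => i; exact: measurable_normal_pdf. Qed.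

Lemma measurable_integrand : measurable_fun setT f.
Proof.
have -> : f = fun x => F x * prod_density q x * (std_normal_density x)^-1.
  apply/funext => x; rewrite /F /gauss_mul /h.
  have := std0 x; have := prod_density_gt0 hq x => q0 s0.
  by field; rewrite !gt_eqF.
apply: measurable_funM.
  apply: measurable_funM; first exact: measurable_gauss_mul.
  exact: measurable_prod_density.
rewrite (_ : (fun x => _) = fun x : 'rV[R]_d =>
    (normal_peak 1 ^+ d)^-1 * expR (enorm x ^+ 2 / 2)); last first.
  by apply/funext => x; rewrite std_normalE invfM -expRN mulNr opprK.
apply: measurable_funM => //; apply: measurableT_comp => //.
apply: measurable_funM => //; apply: measurable_funX; exact: measurable_enorm.
Qed.

(** The target expectation is the expectation of [F] under the proposal; both
    are differences of the integrals of the positive and negative parts. *)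
Lemma target_expectation : ('E_P'[f \o X] = \int[Q]_x (F x)%:E)%E.
Proof.
have mf := measurable_integrand; have mF := measurable_gauss_mul.
have mfE : measurable_fun setT (EFin \o f) by exact/measurable_EFinP.
have mFE : measurable_fun setT (EFin \o F) by exact/measurable_EFinP.
have s0 x : 0 <= @std_normal_density R d x by exact: ltW.
have E1 x : f x * std_normal_density x = F x * prod_density q x.
  rewrite /F /gauss_mul /h; have := prod_density_gt0 hq x => q0.
  by field; rewrite gt_eqF.
rewrite unlock integralE [RHS]integralE; congr (_ - _)%E.
  transitivity (\int[P']_w ((EFin \o f)^\+ (X w)))%E.
    by apply: eq_integral => w _; rewrite !funeposE.
  rewrite (ge0_expectation_density mstd s0 hX)//; last exact: measurable_funepos.
  rewrite ge0_integral_proposal//; last exact: measurable_funepos.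
  apply: eq_integral => x _; rewrite !funeposE /=.
  rewrite -!EFin_max -!EFinM !maxr_pMl ?(prod_density_ge0 hq)//.
  by rewrite E1 !mul0r.
transitivity (\int[P']_w ((EFin \o f)^\- (X w)))%E.
  by apply: eq_integral => w _; rewrite !funenegE.
rewrite (ge0_expectation_density mstd s0 hX)//; last exact: measurable_funeneg.
rewrite ge0_integral_proposal//; last exact: measurable_funeneg.
apply: eq_integral => x _; rewrite !funenegE /=.
rewrite -!EFin_max -!EFinM !maxr_pMl ?(prod_density_ge0 hq)//.
by rewrite !mulNr E1 !mul0r.
Qed.

End target.

End importance_sampling.

(** * Bound of the mean square error *)

Lemma sqr_mean_le (R : realType) n (u : 'I_n -> R) : (0 < n)%N ->
  (n%:R^-1 * \sum_j u j) ^+ 2 <= n%:R^-1 * \sum_j u j ^+ 2.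
Proof.
move=> n0; have nR : 0 < n%:R :> R by rewrite ltr0n.
set m := n%:R^-1 * \sum_j u j.
have sm : \sum_j u j = n%:R * m by rewrite /m mulrA divff ?mul1r// gt_eqF.
have : 0 <= \sum_j (u j - m) ^+ 2 by apply: sumr_ge0 => j _; exact: sqr_ge0.
rewrite (eq_bigr (fun j => u j ^+ 2 - (2 * m) * u j + m ^+ 2)); last first.
  by move=> j _; ring.
rewrite big_split /= sumrB -mulr_sumr sm sumr_const card_ord -[m ^+ 2 *+ n]mulr_natl.
move=> H; rewrite [X in _ <= X]mulrC ler_pdivlMr// -subr_ge0.
by apply: le_trans H _; rewrite le_eqVlt; apply/orP; left; apply/eqP; ring.
Qed.

Lemma sqr_add3_le (R : realType) (a b c : R) :
  (a + b + c) ^+ 2 <= 3 * (a ^+ 2 + b ^+ 2 + c ^+ 2).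
Proof.
rewrite -subr_ge0.
rewrite (_ : _ - _ = (a - b) ^+ 2 + (b - c) ^+ 2 + (a - c) ^+ 2); last by ring.
by rewrite !addr_ge0 ?sqr_ge0.
Qed.

Section mean_square_error.
Context (R : realType) (d : nat) (q : 'I_d -> R -> R).
Hypothesis hq : forall j, is_positive_density (q j).
Variables (f : 'rV[R]_d -> R) (A B C : R).
Let h := fun x => f x / prod_density q x.
Hypothesis hf : class_S h.
Hypotheses (A_gt0 : 0 < A) (B_gt0 : 0 < B) (C_gt0 : 0 < C).
Hypothesis h_growth : forall (u : {set 'I_d}) (x : 'rV[R]_d),
  `|mixed_partial u h x| <= C * expR (A * enorm x ^+ 2 + B * enorm x).
Context d1 (T : measurableType d1) (P : probability T R).
Variable y : forall n, 'I_n -> {RV P >-> 'rV[R]_d}.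
Hypothesis y_cube : forall n (j : 'I_n) w, unit_cube (y j w).
Hypothesis y_unif : forall n (j : 'I_n), has_density (y j) \1_(@unit_cube R d).
Context d2 (T' : measurableType d2) (P' : probability T' R).
Variable X : {RV P' >-> 'rV[R]_d}.
Hypothesis hX : has_density X (@std_normal_density R d).

Let F := gauss_mul h.
Let Q := proposal hq.

Variables (r S tau : R).
Hypotheses (r_gt0 : 0 < r) (S_ge0 : 0 <= S) (tau_gt0 : 0 < tau).
Hypothesis HS : forall x : 'rV[R]_d, (forall i, `|x ord0 i| <= r) -> box_bound A B C
  x <= S.

Let tail (x : 'rV[R]_d) := tail_bound A B C x * \1_[set z : 'rV[R]_d | r - 1 <= enorm
  z] x.
Hypothesis Htau : (\int[Q]_x (tail x ^+ 2)%:E <= tau%:E)%E.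

Let g := truncated h r.
Let k x := `|F x - g x|.

Let mF : measurable_fun setT F.
Proof. exact: (measurable_gauss_mul hf A_gt0 B_gt0 C_gt0 h_growth). Qed.

Let mg : measurable_fun setT g.
Proof. exact: (measurable_truncated hf A_gt0 B_gt0 C_gt0 h_growth). Qed.

Let mk : measurable_fun setT k.
Proof. by apply: measurableT_comp => //; exact: measurable_funB. Qed.

Let mtail : measurable_fun setT tail. Proof. exact: measurable_tail. Qed.

Let k_tail x : k x <= tail x.
Proof. exact: (norm_truncation_error h_growth). Qed.

Let int_sq : (\int[Q]_x (k x ^+ 2)%:E <= tau%:E)%E.
Proof.
apply: le_trans Htau; apply: ge0_le_integral => //.
- by move=> x _; rewrite lee_fin sqr_ge0.
- by apply/measurable_EFinP; exact: measurable_funX.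
- by apply/measurable_EFinP; exact: measurable_funX.
- move=> x _; have k0 : 0 <= k x by exact: normr_ge0.
  by rewrite lee_fin lerXn2r ?nnegrE// (le_trans k0).
Qed.

(* AM-GM turns the bound on the second moment into one on the first moment. *)
Let int_k : (\int[Q]_x (k x)%:E <= (Num.sqrt tau)%:E)%E.
Proof.
pose t := Num.sqrt tau; have t0 : 0 < t by rewrite sqrtr_gt0.
have tt : t ^+ 2 = tau by rewrite sqr_sqrtr// ltW.
apply: (@le_trans _ _ (\int[Q]_x (((2 * t)^-1)%:E * (k x ^+ 2)%:E + (t / 2)%:E))%E).
  apply: ge0_le_integral => //.
  - by move=> x _; rewrite lee_fin normr_ge0.
  - by apply/measurable_EFinP; exact: mk.
  - apply: emeasurable_funD => //; apply: emeasurable_funM => //.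
    by apply/measurable_EFinP; exact: measurable_funX.
  - move=> x _; rewrite -EFinM -EFinD lee_fin -subr_ge0.
    rewrite (_ : _ - _ = (k x - t) ^+ 2 / (2 * t)).
      by rewrite divr_ge0 ?sqr_ge0// mulr_ge0// ltW.
    by field; rewrite gt_eqF.
rewrite ge0_integralD//=; last 3 first.
- by move=> x _; rewrite -EFinM lee_fin mulr_ge0 ?sqr_ge0// invr_ge0 mulr_ge0// ltW.
- apply: emeasurable_funM => //; apply/measurable_EFinP; exact: measurable_funX.
- by move=> x _; rewrite lee_fin divr_ge0// ltW.
rewrite integral_cst// [X in (_ + _ * X <= _)%E]proposal_setT mule1.
rewrite ge0_integralZl_EFin//; last 3 first.
- by move=> x _; rewrite lee_fin sqr_ge0.
- by apply/measurable_EFinP; exact: measurable_funX.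
- by rewrite invr_ge0 mulr_ge0// ltW.
apply: (@le_trans _ _ (((2 * t)^-1)%:E * tau%:E + (t / 2)%:E)%E).
  by apply: leeD => //; apply: lee_wpmul2l => //; rewrite lee_fin invr_ge0 mulr_ge0 ?ltW.
rewrite -EFinM -EFinD lee_fin -/t -tt le_eqVlt; apply/orP; left; apply/eqP.
by field; rewrite gt_eqF.
Qed.

Let gS x : `|g x| <= S. Proof. exact: (norm_truncated_le h_growth). Qed.

Let ig : Q.-integrable setT (EFin \o g).
Proof. exact: bounded_proposal_integrable mg gS. Qed.

Let ik : Q.-integrable setT (EFin \o (fun x => F x - g x)).
Proof.
apply/integrableP; split; first by apply/measurable_EFinP; exact: measurable_funB.
by apply: le_lt_trans int_k _; rewrite ltry.
Qed.

Let iF : Q.-integrable setT (EFin \o F).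
Proof.
rewrite (_ : EFin \o F = ((EFin \o (fun x => (F x - g x)%R)) \+ (EFin \o g))%E).
  exact: integrableD.
by apply/funext => x /=; rewrite -EFinD subrK.
Qed.

Let muF := fine (\int[Q]_x (F x)%:E)%E.
Let mug := fine (\int[Q]_x (g x)%:E)%E.

Let muB : `|mug - muF| <= Num.sqrt tau.
Proof.
rewrite -lee_fin; apply: le_trans int_k.
apply: le_trans (le_abse_integral _ measurableT (measurable_int _ ik)).
rewrite integralB_EFin//.
rewrite -(fineK (integrable_fin_num measurableT iF)).
rewrite -(fineK (integrable_fin_num measurableT ig)).
by rewrite -EFinB abse_EFin lee_fin distrC.
Qed.

(** Mean square error: Koksma--Hlawka controls the truncated integrand, and the
    second moment of the tail controls both the remainder of the average and
    the remainder of the expectation. *)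
Lemma IS_mse_le n (D : R) : (0 < n)%N ->
  {ae P, forall w, star_discrepancy (fun j : 'I_n => y j w : 'rV[R]_d) <= D} ->
  (IS_mse q f y X n <= (3 * (2 * tau + (D * ((2 * r) ^+ d * S)) ^+ 2))%:E)%E.
Proof.
move=> n0 HD; set V := (2 * r) ^+ d * S.
have V0 : 0 <= V by rewrite mulr_ge0// exprn_ge0// mulr_ge0// ltW.
have nR : 0 < n%:R :> R by rewrite ltr0n.
pose x (j : 'I_n) w := inv_cdf_row q (y j w).
have mx j : measurable_fun setT (x j) by exact: (measurable_inv_RV hq).
pose a2 w := n%:R^-1 * \sum_(j < n) k (x j w) ^+ 2.
have ma2 : measurable_fun setT a2.
  apply: measurable_funM => //; apply: measurable_sum => j.
  by apply: measurable_funX; exact: (measurableT_comp mk).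
have a20 w : 0 <= a2 w.
  by rewrite mulr_ge0 ?invr_ge0 ?(ltW nR)// sumr_ge0// => j _; exact: sqr_ge0.
pose I w := n%:R^-1 * \sum_(j < n) F (x j w).
have mI : measurable_fun setT I.
  apply: measurable_funM => //; apply: measurable_sum => j.
  exact: (measurableT_comp mF).
have IE w : IS_estimator q f (fun j : 'I_n => y j w) = I w.
  by rewrite /IS_estimator; congr (_ * _); apply: eq_bigr => j _; exact: f_ISE.
have -> : IS_mse q f y X n = (\int[P]_w ((I w - muF) ^+ 2)%:E)%E.
  rewrite /IS_mse (target_expectation hq hf A_gt0 B_gt0 C_gt0 h_growth hX).
  rewrite -(fineK (integrable_fin_num measurableT iF)) -/muF.
  by apply: eq_integral => w _; rewrite IE -EFinB -EFin_expe.
pose ub w := 3 * (a2 w + (D * V) ^+ 2 + tau).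
have mub : measurable_fun setT ub.
  by apply: measurable_funM => //; apply: measurable_funD => //; exact: measurable_funD.
have ub0 w : 0 <= ub w.
  by rewrite mulr_ge0// !addr_ge0 ?sqr_ge0// ltW.
apply: (@le_trans _ _ (\int[P]_w (ub w)%:E)%E).
  apply: ae_ge0_le_integral => //.
  - by move=> w _; rewrite lee_fin sqr_ge0.
  - by apply/measurable_EFinP; apply: measurable_funX; exact: measurable_funB.
  - by move=> w _; rewrite lee_fin.
  - exact/measurable_EFinP.
  have Hy : {ae P, forall w, forall (j : 'I_n) i, 0 < y j w ord0 i < 1}.
    by apply: filter_forall => j; apply: uniform_gt0_ae (y_unif j) (y_cube j).
  apply: filterS2 HD Hy => w wD wy _; rewrite lee_fin.
  have KH : `|(\sum_j g (x j w)) / n%:R - mug| <= D * V.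
    have KH := @koksma_hlawka R d q hq r S S g r_gt0 (@truncated_continuous R d h hf r)
      (@truncated_supp R d h r) (truncated_derivable hf r)
      (fun z => norm_truncated_partial hf C_gt0 h_growth z S_ge0 HS) gS n
      (fun j => y j w) wy.
    by apply: le_trans KH _; rewrite ler_wpM2r.
  have Ha : `|I w - (\sum_j g (x j w)) / n%:R| <= n%:R^-1 * \sum_j k (x j w).
    rewrite /I [X in _ - X]mulrC -mulrBr normrM ger0_norm ?invr_ge0 ?(ltW nR)//.
    rewrite ler_wpM2l ?invr_ge0 ?(ltW nR)// -sumrB.
    exact: ler_norm_sum.
  have Ha2 : (n%:R^-1 * \sum_j k (x j w)) ^+ 2 <= a2 w.
    exact: sqr_mean_le.
  have k0 : 0 <= n%:R^-1 * \sum_j k (x j w).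
    by rewrite mulr_ge0 ?invr_ge0 ?(ltW nR)// sumr_ge0// => j _; exact: normr_ge0.
  have tt : Num.sqrt tau ^+ 2 = tau by rewrite sqr_sqrtr// ltW.
  have H3 : `|I w - muF| <= n%:R^-1 * \sum_j k (x j w) + D * V + Num.sqrt tau.
    rewrite (_ : I w - muF = (I w - (\sum_j g (x j w)) / n%:R) +
      ((\sum_j g (x j w)) / n%:R - mug) + (mug - muF)); last by ring.
    by do 2![apply: le_trans (ler_normD _ _) _; apply: lerD => //].
  rewrite -(ger0_norm (sqr_ge0 (I w - muF))) normrX.
  apply: (@le_trans _ _ ((n%:R^-1 * \sum_j k (x j w) + D * V + Num.sqrt tau) ^+ 2)).
    by rewrite lerXn2r// nnegrE// (le_trans _ H3).
  apply: (@le_trans _ _ (3 * ((n%:R^-1 * \sum_j k (x j w)) ^+ 2 + (D * V) ^+ 2 +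
    Num.sqrt tau ^+ 2))).
    exact: sqr_add3_le.
  by rewrite tt ler_pM2l// lerD2r lerD2r.
rewrite /ub; under eq_integral do rewrite EFinM.
rewrite ge0_integralZl_EFin//; last 2 first.
- by move=> w _; rewrite lee_fin !addr_ge0 ?sqr_ge0// ltW.
- by apply/measurable_EFinP; apply: measurable_funD => //; exact: measurable_funD.
rewrite EFinM lee_pmul2l ?lte_fin//.
under eq_integral do rewrite -addrA EFinD.
have c0 : 0 <= (D * V) ^+ 2 + tau by rewrite addr_ge0 ?sqr_ge0// ltW.
rewrite ge0_integralD//=; last 2 first.
- by move=> w _; rewrite lee_fin.
- exact/measurable_EFinP.
rewrite integral_cst//= probability_setT mule1.
rewrite (_ : 2 * tau + _ = tau + ((D * V) ^+ 2 + tau)); last by ring.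
rewrite [X in (_ <= X)%E]EFinD; apply: leeD => //.
rewrite /a2; under eq_integral do rewrite EFinM.
rewrite ge0_integralZl_EFin ?invr_ge0 ?(ltW nR)//; last 2 first.
- by move=> w _; rewrite lee_fin sumr_ge0// => j _; exact: sqr_ge0.
- apply/measurable_EFinP; apply: measurable_sum => j.
  by apply: measurable_funX; exact: (measurableT_comp mk).
under eq_integral do rewrite -sumEFin.
rewrite ge0_integral_sum//; last 2 first.
- move=> j; apply/measurable_EFinP.
  by apply: measurable_funX; exact: (measurableT_comp mk).
- by move=> j w _; rewrite lee_fin sqr_ge0.
have Ej j : (\int[P]_w (k (x j w) ^+ 2)%:E <= tau%:E)%E.
  apply: le_trans int_sq.
  rewrite (ge0_integral_inv hq (y_unif j) (g := fun z => (k z ^+ 2)%:E))//.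
  - by apply/measurable_EFinP; exact: measurable_funX.
  - by move=> z; rewrite lee_fin sqr_ge0.
apply: (@le_trans _ _ ((n%:R^-1)%:E * \sum_(j < n) tau%:E)%E).
  by apply: lee_wpmul2l; [rewrite lee_fin invr_ge0 (ltW nR)|apply: lee_sum => j _].
rewrite sumEFin -EFinM lee_fin sumr_const card_ord -[tau *+ n]mulr_natl mulrA.
by rewrite mulVf ?mul1r// gt_eqF.
Qed.

End mean_square_error.

(** * Elementary estimates *)

Section rates.
Context (R : realType) (d : nat).
Implicit Types (x : 'rV[R]_d).

Lemma ln_nat_ge (L0 : R) : \forall n \near \oo, L0 <= ln (n%:R : R).
Proof.
near=> n; have h : expR L0 <= n%:R by near: n; exact: nbhs_infty_ger.
by rewrite -(expRK L0) ler_ln ?posrE ?expR_gt0// (lt_le_trans _ h)// expR_gt0.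
Unshelve. all: end_near. Qed.

Lemma expR_m2ln n : (0 < n)%N -> expR (- (2 * ln n%:R)) = n%:R ^- 2 :> R.
Proof.
by move=> n0; rewrite expRN expRM_natl lnK// posrE ltr0n.
Qed.

(** A Gaussian factor absorbs a linear exponential. *)
Lemma sqr_exponent_le (e b s : R) : 0 < e -> - e * s ^+ 2 + b * s <= b ^+ 2 / (4 * e).
Proof.
move=> e0; rewrite -subr_ge0.
rewrite (_ : _ - _ = (2 * e * s - b) ^+ 2 / (4 * e)); last by field; rewrite gt_eqF.
by rewrite divr_ge0 ?sqr_ge0// mulr_ge0// ltW.
Qed.

Lemma prod_4D_le x : \prod_i (4 + `|x ord0 i|) <= expR (d%:R * (3 + enorm x)).
Proof.
rewrite expRM_natl -[d in _ ^+ d]card_ord -prodr_const; apply: ler_prod => i _.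
rewrite addr_ge0//=; apply: (@le_trans _ _ (expR (3 + `|x ord0 i|))).
  by apply: le_trans (expR_ge1Dx _); rewrite addrA.
by rewrite ler_expR lerD2l norm_coord_le_enorm.
Qed.

Lemma prod_4D_le_box (r : R) x : 0 <= r -> (forall i, `|x ord0 i| <= r) ->
  \prod_i (4 + `|x ord0 i|) <= (4 + r) ^+ d.
Proof.
move=> r0 xr; rewrite -[d in _ ^+ d]card_ord -prodr_const; apply: ler_prod => i _.
by rewrite addr_ge0//= lerD2l.
Qed.

(** A real power is dominated by any increasing exponential. *)
Lemma powR_le_expR (a b r : R) : 0 < a -> 0 < b -> 0 < r ->
  r `^ a <= (a / b) `^ a * expR (b * r).
Proof.
move=> a0 b0 r0; have c0 : 0 < a / b by rewrite divr_gt0.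
have h : r <= (a / b) * expR (r / (a / b)).
  rewrite mulrC -ler_pdivrMr//; apply: le_trans (expR_ge1Dx _).
  by rewrite lerDr.
apply: (@le_trans _ _ (((a / b) * expR (r / (a / b))) `^ a)).
  by rewrite ge0_ler_powR ?nnegrE ?(ltW a0) ?(ltW r0)// mulr_ge0 ?expR_ge0// ltW.
rewrite powRM ?expR_ge0 ?(ltW c0)// -expRM.
rewrite (_ : r / (a / b) * a = b * r)//.
by field; rewrite !gt_eqF.
Qed.

End rates.

(** * Convergence rates *)

Lemma rate_exponentE d : (0 < d)%N -> (3 * d - 2 = 2 * d.-1 + d)%N.
Proof. by lia. Qed.

Section convergence_rates.
Context (R : realType) (d : nat) (q : 'I_d -> R -> R).
Hypothesis d_gt0 : (0 < d)%N.
Hypothesis hq : forall j, is_positive_density (q j).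
Variables (f : 'rV[R]_d -> R) (A B C : R).
Let h := fun x => f x / prod_density q x.
Hypothesis hf : class_S h.
Hypotheses (A_gt0 : 0 < A) (B_gt0 : 0 < B) (C_gt0 : 0 < C).
Hypothesis h_growth : forall (u : {set 'I_d}) (x : 'rV[R]_d),
  `|mixed_partial u h x| <= C * expR (A * enorm x ^+ 2 + B * enorm x).
Context d1 (T : measurableType d1) (P : probability T R).
Variable y : forall n, 'I_n -> {RV P >-> 'rV[R]_d}.
Hypothesis hy : is_rqmc y.
Context d2 (T' : measurableType d2) (P' : probability T' R).
Variable X : {RV P' >-> 'rV[R]_d}.
Hypothesis hX : has_density X (@std_normal_density R d).

Let c := C * normal_peak 1 ^+ d.

Let c_gt0 : 0 < c.
Proof. by rewrite mulr_gt0// exprn_gt0// normal_peak_gt0 ?oner_eq0. Qed.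

(** Subcritical growth: the mixed derivatives of the truncations are bounded
    uniformly in [r], and a box of side of order [sqrt (ln n)], of volume of order
    [(ln n) ^ (d / 2)], leaves a remainder of order [1 / n]. *)
Lemma IS_mse_subcritical : A < 1 / 2 ->
  ereal_bigO (IS_mse q f y X) (fun n => n%:R ^- 2 * ln n%:R ^+ (3 * d - 2)).
Proof.
move=> A_lt; case: hy => y_cube y_unif [C' y_disc].
pose e := 1 / 2 - A; have e0 : 0 < e by rewrite subr_gt0.
have AE : A - 2^-1 = - e by rewrite /e; field.
pose K1 := c ^+ 2 * expR (B ^+ 2 / e).
have K1_gt0 : 0 < K1 by rewrite mulr_gt0 ?exprn_gt0 ?expR_gt0.
pose S := 2 ^+ d * c * expR ((B + d%:R) ^+ 2 / (4 * e) + 3 * d%:R).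
have S0 : 0 <= S by rewrite mulr_ge0 ?expR_ge0// mulr_ge0 ?exprn_ge0 ?(ltW c_gt0).
have HS (x : 'rV[R]_d) : box_bound A B C x <= S.
  rewrite /box_bound /tail_bound -/c AE /S -[c * _ * _]mulrA mulrA.
  rewrite ler_pM2l ?(mulr_gt0 (exprn_gt0 _ _) c_gt0)//.
  apply: (@le_trans _ _ (expR (- e * enorm x ^+ 2 + B * enorm x) *
      expR (d%:R * (3 + enorm x)))).
    by rewrite ler_pM2l ?expR_gt0//; exact: prod_4D_le.
  rewrite -expRD ler_expR.
  have := sqr_exponent_le (B + d%:R) (enorm x) e0; lra.
pose K2 := 1 + Num.sqrt (2 / e).
have K2_ge0 : 0 <= K2 by rewrite addr_ge0// sqrtr_ge0.
rewrite /ereal_bigO; exists (3 * (2 * K1 + C' ^+ 2 * ((4 * K2 ^+ 2) ^+ d * S ^+ 2))).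
near=> n.
have L1 : 1 <= ln n%:R :> R by near: n; exact: ln_nat_ge.
have n1 : (1 < n)%N by near: n; exists 2%N.
have n0 : (0 < n)%N by exact: ltnW.
set L := ln n%:R in L1 *.
have L0 : 0 <= L by exact: le_trans L1.
(* The tail beyond [m] contributes [exp (- e * m ^ 2) = 1 / n ^ 2]. *)
pose m := Num.sqrt (2 / e * L).
have m2 : m ^+ 2 = 2 / e * L by rewrite sqr_sqrtr// mulr_ge0// divr_ge0// ltW.
have m0 : 0 <= m by exact: sqrtr_ge0.
pose r := 1 + m; have r0 : 0 < r by rewrite ltr_pwDl.
pose tau := K1 * n%:R ^- 2.
have nN2 : 0 < n%:R ^- 2 :> R by rewrite invr_gt0 exprn_gt0// ltr0n.
have tau0 : 0 < tau by rewrite mulr_gt0.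
have Htau : (\int[proposal hq]_x ((tail_bound A B C x *
    \1_[set z : 'rV[R]_d | r - 1 <= enorm z] x) ^+ 2)%:E <= tau%:E)%E.
  rewrite -[leRHS]mule1 -(proposal_setT hq) -integral_cst//.
  apply: ge0_le_integral => //.
  - by move=> x _; rewrite lee_fin sqr_ge0.
  - by apply/measurable_EFinP; apply: measurable_funX; exact: measurable_tail.
  move=> x _; rewrite lee_fin indicE; case: (boolP (x \in _)) => [|_]; last first.
    by rewrite mulr0 expr0n ltW.
  rewrite inE /= mulr1 => xr; have mx : m <= enorm x by move: xr; rewrite /r; lra.
  rewrite /tail_bound -/c AE exprMn /tau /K1 -mulrA ler_pM2l ?exprn_gt0//.
  rewrite -expRM_natl -(expR_m2ln R n0) -expRD ler_expR -/L.
  have mm : m ^+ 2 <= enorm x ^+ 2 by rewrite lerXn2r// nnegrE// enorm_ge0.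
  have em : e * m ^+ 2 = 2 * L by rewrite m2; field; rewrite gt_eqF.
  have em2 : e * m ^+ 2 <= e * enorm x ^+ 2 by rewrite ler_pM2l.
  have := sqr_exponent_le (2 * B) (enorm x) e0.
  rewrite (_ : (2 * B) ^+ 2 / (4 * e) = B ^+ 2 / e); last by field; rewrite gt_eqF.
  lra.
have H := IS_mse_le hf A_gt0 B_gt0 C_gt0 h_growth y_cube y_unif hX
  r0 S0 tau0 (fun x _ => HS x) Htau n0 (y_disc n n1).
apply: le_trans H _.
rewrite lee_fin -[leRHS]mulrA ler_pM2l// [leRHS]mulrDl; apply: lerD.
  rewrite /tau -[leRHS]mulrA ler_pM2l// ler_pM2l// ler_peMr ?(ltW nN2)//.
  by rewrite exprn_ege1.
have rK : r ^+ 2 <= K2 ^+ 2 * L.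
  have -> : K2 ^+ 2 * L = (K2 * Num.sqrt L) ^+ 2 by rewrite exprMn sqr_sqrtr.
  rewrite lerXn2r ?nnegrE ?(ltW r0) ?mulr_ge0 ?sqrtr_ge0//.
  rewrite /r /K2 mulrDl mul1r; apply: lerD.
    by rewrite -sqrtr1 ler_wsqrtr.
  by rewrite /m sqrtrM// divr_ge0// ltW.
rewrite -/L; have -> : (C' * L ^+ d.-1 / n%:R * ((2 * r) ^+ d * S)) ^+ 2 =
    C' ^+ 2 * ((4 * r ^+ 2) ^+ d * S ^+ 2) * (n%:R ^- 2 * L ^+ (2 * d.-1)).
  rewrite (_ : 4 * r ^+ 2 = (2 * r) ^+ 2); last by ring.
  rewrite -exprM [(2 * d)%N]mulnC exprM [(2 * d.-1)%N]mulnC exprM -exprVn.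
  by ring.
rewrite (rate_exponentE d_gt0).
rewrite exprD -[X in _ <= X]mulrA -[X in X <= _]mulrA; apply: ler_wpM2l;
  first exact: sqr_ge0.
rewrite [leRHS](_ : _ = (4 * K2 ^+ 2 * L) ^+ d * (S ^+ 2 * (n%:R ^- 2 * L ^+ (2 *
  d.-1)))); last first.
  by rewrite [(4 * K2 ^+ 2 * L) ^+ d]exprMn; ring.
rewrite -[leLHS]mulrA; apply: ler_wpM2r.
  by rewrite mulr_ge0 ?sqr_ge0// mulr_ge0 ?(ltW nN2)// exprn_ge0.
have r4 : 4 * r ^+ 2 <= 4 * K2 ^+ 2 * L by rewrite -[leRHS]mulrA ler_pM2l.
have r40 : 0 <= 4 * r ^+ 2 by rewrite mulr_ge0// sqr_ge0.
by rewrite lerXn2r// nnegrE// (le_trans r40).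
Unshelve. all: end_near. Qed.


(** Critical growth: truncating at the [r] with [beta * r ^ gamma = 2 * ln n]
    makes the tail moment of order [r ^ alpha / n ^ 2]; the mixed derivative is
    then of order [r ^ d * exp (B * sqrt d * r)] on the box. *)
Lemma IS_mse_critical (alpha beta gamma C0 : R) : A = 1 / 2 ->
  0 < alpha -> 0 < beta -> 1 < gamma -> 0 < C0 ->
  (forall r : R, 1 < r ->
     (density_expectation q (fun x =>
        (enorm x ^+ 4 * expR (2 * B * enorm x) *
         \1_[set z : 'rV[R]_d | r - 1 <= enorm z] x)%R)
      <= (C0 * r `^ alpha * expR (- beta * r `^ gamma))%:E)%E) ->
  ereal_bigO (IS_mse q f y X)
    (fun n => n%:R ^- 2
       * ln n%:R `^ (4 * d%:R / gamma + 2 * d%:R - 2)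
       * expR (2 * Num.sqrt d%:R * B * (2 / beta) `^ gamma^-1
               * ln n%:R `^ gamma^-1)).
Proof.
move=> A_eq a0 b0 g1 C00 moment; case: hy => y_cube y_unif [C' y_disc].
have AE : A - 2^-1 = 0 by rewrite A_eq; field.
have g0 : 0 < gamma by exact: lt_trans g1.
have c2 : 0 < c ^+ 2 by exact: exprn_gt0.
pose sd : R := Num.sqrt d%:R; have sd0 : 0 < sd by rewrite sqrtr_gt0 ltr0n.
pose b' := 2 * sd * B; have b'0 : 0 < b' by rewrite !mulr_gt0.
pose K3 := 2 ^+ d * c * 3 ^+ d.
have K30 : 0 < K3.
  exact: mulr_gt0 (mulr_gt0 (exprn_gt0 _ _) c_gt0) (exprn_gt0 _ _).
pose K5 := (alpha / b') `^ alpha.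
pose p := 4 * d%:R / gamma.
have p0 : 0 <= p by rewrite divr_ge0 ?(ltW g0)// mulr_ge0.
pose K4 := 4 ^+ d * K3 ^+ 2 * (2 / beta) `^ p.
rewrite /ereal_bigO; exists (3 * (2 * (c ^+ 2 * C0 * K5) + C' ^+ 2 * K4)).
near=> n.
have L1 : 1 <= ln n%:R :> R by near: n; exact: ln_nat_ge.
have Lr : beta / 2 * 2 `^ gamma <= ln n%:R :> R by near: n; exact: ln_nat_ge.
have n1 : (1 < n)%N by near: n; exists 2%N.
have n0 : (0 < n)%N by exact: ltnW.
set L := ln n%:R in L1 Lr *.
have L0 : 0 < L by exact: lt_le_trans L1.
have bL : 0 < 2 / beta by rewrite divr_gt0.
(* The solution of [beta * r ^ gamma = 2 * ln n]. *)
have [r rE] : exists r, r = (2 / beta * L) `^ gamma^-1 by eexists.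
have rg : r `^ gamma = 2 / beta * L.
  by rewrite rE -powRrM mulVf ?gt_eqF// powRr1// ltW// mulr_gt0.
(* Then [r - 1 >= 1], so the fourth power in the moment is at least 1 on the tail,
   and [4 + r <= 3 * r]. *)
have r2 : 2 <= r.
  have E2 : (2 `^ gamma) `^ gamma^-1 = 2 :> R.
    by rewrite -powRrM divff ?powRr1// gt_eqF.
  rewrite -E2 rE.
  rewrite ge0_ler_powR ?invr_ge0 ?(ltW g0) ?nnegrE ?powR_ge0//.
    by rewrite mulr_ge0 ?(ltW bL) ?(ltW L0).
  rewrite (_ : 2 `^ gamma = 2 / beta * (beta / 2 * 2 `^ gamma)); last by field;
    rewrite gt_eqF.
  by rewrite ler_pM2l.
have r0 : 0 < r by exact: lt_le_trans r2.
have r1 : 1 < r by lra.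
have nN2 : 0 < n%:R ^- 2 :> R by rewrite invr_gt0 exprn_gt0// ltr0n.
pose E := expR (b' * r).
have EE : expR (2 * Num.sqrt d%:R * B * (2 / beta) `^ gamma^-1 * L `^ gamma^-1) = E.
  by rewrite /E /b' rE (@powRM _ (2 / beta) L) ?(ltW bL) ?(ltW L0)// mulrA.
pose S := K3 * r ^+ d * expR (B * (sd * r)).
have S0 : 0 <= S by rewrite mulr_ge0 ?expR_ge0// mulr_ge0 ?exprn_ge0// ltW.
have HS (x : 'rV[R]_d) : (forall i, `|x ord0 i| <= r) -> box_bound A B C x <= S.
  move=> xr; rewrite /box_bound /tail_bound -/c AE mul0r add0r.
  have h1 : expR (B * enorm x) <= expR (B * (sd * r)).
    by rewrite ler_expR ler_pM2l// enorm_le_box// ltW.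
  have h2 : \prod_i (4 + `|x ord0 i|) <= 3 ^+ d * r ^+ d.
    apply: le_trans (prod_4D_le_box (ltW r0) xr) _.
    by rewrite -exprMn lerXn2r ?nnegrE ?addr_ge0 ?mulr_ge0 ?(ltW r0)//; lra.
  have h3 : 0 <= \prod_i (4 + `|x ord0 i|).
    by apply: prodr_ge0 => i _; rewrite addr_ge0.
  rewrite [leRHS](_ : _ = 2 ^+ d * (c * expR (B * (sd * r)) * (3 ^+ d * r ^+ d)));
    last first.
    by rewrite /S /K3; ring.
  rewrite ler_pM2l ?exprn_gt0//; apply: ler_pM => //.
    exact: mulr_ge0 (ltW c_gt0) (expR_ge0 _).
  by rewrite ler_pM2l.
pose tau := c ^+ 2 * C0 * r `^ alpha * n%:R ^- 2.
have tau0 : 0 < tau by rewrite mulr_gt0// mulr_gt0 ?powR_gt0// mulr_gt0.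
pose mom (x : 'rV[R]_d) := enorm x ^+ 4 * expR (2 * B * enorm x) *
  \1_[set z : 'rV[R]_d | r - 1 <= enorm z] x.
have mset : measurable [set z : 'rV[R]_d | r - 1 <= enorm z].
  rewrite (_ : [set z | _] = @enorm R d @^-1` `[r - 1, +oo[%classic).
    by rewrite -[X in measurable X]setTI; apply: measurable_enorm => //;
      exact: measurable_itv.
  by apply/seteqP; split=> z /=; rewrite in_itv /= andbT.
have me := @measurable_enorm R d.
have mmom : measurable_fun setT mom.
  apply: measurable_funM; last exact: measurable_indic.
  apply: measurable_funM; first exact: measurable_funX.
  by apply: measurableT_comp => //; exact: measurable_funM.
have mom0 x : 0 <= mom x.
  by rewrite mulr_ge0 ?indicE// mulr_ge0 ?expR_ge0// exprn_ge0// enorm_ge0.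
have Htau : (\int[proposal hq]_x ((tail_bound A B C x *
    \1_[set z : 'rV[R]_d | r - 1 <= enorm z] x) ^+ 2)%:E <= tau%:E)%E.
  apply: (@le_trans _ _ (\int[proposal hq]_x ((c ^+ 2)%:E * (mom x)%:E))%E).
    apply: ge0_le_integral => //.
    - by move=> x _; rewrite lee_fin sqr_ge0.
    - by apply/measurable_EFinP; apply: measurable_funX; exact: measurable_tail.
    - by apply: emeasurable_funM => //; exact/measurable_EFinP.
    move=> x _; rewrite -EFinM lee_fin /mom indicE.
    case: (boolP (x \in _)) => [|_]; last by rewrite !mulr0 expr0n.
    rewrite inE /= !mulr1 => xr; have x1 : 1 <= enorm x by lra.
    rewrite /tail_bound -/c AE mul0r add0r exprMn ler_pM2l// -expRM_natl mulrA.
    by rewrite ler_peMl ?expR_ge0// exprn_ege1.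
  rewrite ge0_integralZl_EFin ?(ltW c2)//; last 2 first.
  - by move=> x _; rewrite lee_fin.
  - exact/measurable_EFinP.
  have -> : tau%:E = ((c ^+ 2)%:E * (C0 * r `^ alpha * n%:R ^- 2)%:E)%E.
    by rewrite -EFinM /tau !mulrA.
  apply: lee_wpmul2l; first by rewrite lee_fin ltW.
  have := moment r r1; rewrite /density_expectation rg.
  rewrite (_ : - beta * (2 / beta * L) = - (2 * L)); last by field; rewrite gt_eqF.
  rewrite expR_m2ln// => Hm; apply: le_trans Hm.
  rewrite ge0_integral_proposal//; last exact/measurable_EFinP.
have H := IS_mse_le hf A_gt0 B_gt0 C_gt0 h_growth y_cube y_unif hX
  r0 S0 tau0 HS Htau n0 (y_disc n n1).
apply: le_trans H _.
rewrite -/L EE.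
pose Lq := L `^ p * L ^+ (2 * d.-1).
have LqE : L `^ (4 * d%:R / gamma + 2 * d%:R - 2) = Lq.
  rewrite -addrA powRD; last by rewrite (gt_eqF L0) implybT.
  rewrite /Lq; congr (_ * _).
  rewrite -powR_mulrn ?(ltW L0)//; congr (_ `^ _).
  by rewrite -[in LHS](prednK d_gt0) natrM -natr1; ring.
have Lq1 : 1 <= Lq.
  apply: mulr_ege1; last exact: exprn_ege1.
  by rewrite -(powRr0 L) ler_powR.
have E0 : 0 < E by exact: expR_gt0.
rewrite LqE lee_fin -[leRHS]mulrA ler_pM2l// [leRHS]mulrDl; apply: lerD.
  rewrite /tau -[leRHS]mulrA ler_pM2l//.
  have hr : r `^ alpha <= K5 * E by exact: powR_le_expR.
  rewrite [leRHS](_ : _ = c ^+ 2 * C0 * (K5 * E * Lq) * n%:R ^- 2); last by ring.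
  rewrite ler_pM2r// (ler_pM2l (mulr_gt0 c2 C00)); apply: le_trans hr _.
  by rewrite ler_peMr// mulr_ge0 ?powR_ge0// ltW.
have rp : r ^+ (4 * d) = (2 / beta) `^ p * L `^ p.
  rewrite -powR_mulrn ?(ltW r0)// rE -powRrM -powRM ?(ltW bL) ?(ltW L0)//.
  by congr (_ `^ _); rewrite /p natrM mulrC.
rewrite le_eqVlt; apply/orP; left; apply/eqP.
have e2 : expR (B * (sd * r)) ^+ 2 = E.
  by rewrite -expRM_natl /E /b'; congr expR; ring.
have r4 : r ^+ (4 * d) = ((r ^+ d) ^+ 2) ^+ 2.
  by rewrite -!exprM mulnC (_ : 4 = 2 * 2)%N// mulnA.
have two4 : 4 ^+ d = (2 ^+ d) ^+ 2 :> R.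
  by rewrite -exprM mulnC exprM; congr (_ ^+ _); ring.
have L2 : L ^+ (2 * d.-1) = (L ^+ d.-1) ^+ 2 by rewrite -exprM mulnC.
rewrite /K4 -e2 /Lq two4 L2 /S.
transitivity (C' ^+ 2 * ((2 ^+ d) ^+ 2 * K3 ^+ 2) * ((2 / beta) `^ p * L `^ p) *
  (n%:R ^- 2 * (L ^+ d.-1) ^+ 2 * expR (B * (sd * r)) ^+ 2)); last by ring.
by rewrite -rp r4 [(2 * r) ^+ d]exprMn -exprVn; ring.
Unshelve. all: end_near. Qed.

End convergence_rates.

Theorem theorem4 (R : realType) (d : nat) (hd : (0 < d)%N)
  (q : 'I_d -> R -> R) (hq : forall j, is_positive_density (q j))
  (f : 'rV[R]_d -> R)
  (hf : class_S (fun x => f x / prod_density q x))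
  (A B C : R) (hA : 0 < A) (hB : 0 < B) (hC : 0 < C)
  (hgrowth : forall (u : {set 'I_d}) (x : 'rV[R]_d),
     `| mixed_partial u (fun z => f z / prod_density q z) x |
     <= C * expR (A * enorm x ^+ 2 + B * enorm x))
  (d1 : measure_display) (T : measurableType d1) (P : probability T R)
  (y : forall n, 'I_n -> {RV P >-> 'rV[R]_d}) (hy : is_rqmc y)
  (d2 : measure_display) (T' : measurableType d2) (P' : probability T' R)
  (X : {RV P' >-> 'rV[R]_d}) (hX : has_density X (@std_normal_density R d)) :
  (A < 1 / 2 ->
   (density_expectation q (fun x => (enorm x ^+ 2)%R) < +oo)%E ->
   ereal_bigO (IS_mse q f y X)
     (fun n => n%:R ^- 2 * ln n%:R ^+ (3 * d - 2)))
  /\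
  (A = 1 / 2 ->
   forall alpha beta gamma C0 : R,
   0 < alpha -> 0 < beta -> 1 < gamma -> 0 < C0 ->
   (forall r : R, 1 < r ->
     (density_expectation q (fun x =>
        (enorm x ^+ 4 * expR (2 * B * enorm x) *
         \1_[set z : 'rV[R]_d | r - 1 <= enorm z] x)%R)
      <= (C0 * r `^ alpha * expR (- beta * r `^ gamma))%:E)%E) ->
   ereal_bigO (IS_mse q f y X)
     (fun n => n%:R ^- 2
        * ln n%:R `^ (4 * d%:R / gamma + 2 * d%:R - 2)
        * expR (2 * Num.sqrt d%:R * B * (2 / beta) `^ gamma^-1
                * ln n%:R `^ gamma^-1))).
Proof.
split=> [A_lt|A_eq alpha beta gamma C0 a0 b0 g1 C00 moment].
  by move=> _; exact: (IS_mse_subcritical hd hq hf hA hB hC hgrowth hy hX).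
exact: (IS_mse_critical hd hq hf hA hB hC hgrowth hy hX A_eq a0 b0 g1 C00 moment).
Qed.
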